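(* Let $d \ge 1$ be an integer and let $\psi \in \Psi_d$. Then $\psi$ has a spherical convolution root that is real-valued and isotropic; that is, there exists an isotropic function $g : \mathbb{S}^d \times \mathbb{S}^d \to \mathbb{R}$ such that \[ \psi(\theta(u,v)) = (g \circledast g)(u,v) \quad \text{for all } u,v \in \mathbb{S}^d . \]
   Context: For an integer $d\ge 1$, $\mathbb{S}^d = \{x \in \mathbb{R}^{d+1} : \lVert x\rVert = 1\}$ is the unit sphere with geodesic distance $\theta(u,v) = \arccos(\langle u,v\rangle) \in [0,\pi]$. A function $f:\mathbb{S}^d\times\mathbb{S}^d \to \mathbb{R}$ is positive definite if $\sum_{i=1}^n\sum_{j=1}^n c_i c_j f(u_i,u_j) \ge 0$ for all finite sets of points $u_1,\dots,u_n \in \mathbb{S}^d$ and all $c_1,\dots,c_n \in \mathbb{R}$. It is isotropic if there is $\bar f:[0,\pi]\to\mathbb{R}$ with $f(u,v) = \bar f(\theta(u,v))$ for all $u,v\in\mathbb{S}^d$. The class $\Psi_d$ consists of all continuous functions $\psi:[0,\pi]\to\mathbb{R}$ with $\psi(0)=1$ such that $(u,v)\mapsto\psi(\theta(u,v))$ is positive definite on $\mathbb{S}^d\times\mathbb{S}^d$. The spherical convolution of $f,g:\mathbb{S}^d\times\mathbb{S}^d\to\mathbb{R}$ is $(f\circledast g)(u,v) = \int_{\mathbb{S}^d} f(u,w)g(w,v)\,dw$ (the integral being required to exist as a Lebesgue integral), where $dw$ denotes integration with respect to the (unnormalised) $d$-dimensional Hausdorff measure on $\mathbb{S}^d$. 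*)

(* Defs.v *)
From mathcomp Require Import all_boot all_order all_algebra.
From mathcomp Require Import all_classical all_reals all_analysis.
Import Order.TTheory GRing.Theory Num.Theory.
Import numFieldNormedType.Exports.

Set Implicit Arguments.
Unset Strict Implicit.
Unset Printing Implicit Defensive.

Local Open Scope classical_set_scope.
Local Open Scope ring_scope.

Section Euclidean.
Context {R : realType} {n : nat}.
Implicit Types u v : 'rV[R]_n.

Definition dotp u v : R := \sum_(i < n) u 0 i * v 0 i.

(* The library norm on 'rV[R]_n is the sup norm, hence this one. *)
Definition enorm u : R := Num.sqrt (dotp u u).

Definition ediam (A : set 'rV[R]_n) : \bar R :=
  ereal_sup (0%E |` [set (enorm (p.1 - p.2))%:E | p in A `*` A]).

End Euclidean.

Section Hausdorff.
Context {R : realType} {n : nat}.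

(* Volume of the unit ball of R^k, by the recurrence V_k = (2 pi / k) V_(k-2);
   it normalises the Hausdorff measure so that H^k is Lebesgue measure on R^k
   and surface area on k-dimensional submanifolds. *)
Fixpoint ball_volume (k : nat) : R :=
  match k with
  | 0 => 1
  | 1 => 2
  | k'.+2 => 2 * pi / k%:R * ball_volume k'
  end.

Definition delta_cover (delta : R) (A : set 'rV[R]_n) : set (set 'rV[R]_n)^nat :=
  [set F | A `<=` \bigcup_k F k /\ forall k, (ediam (F k) <= delta%:E)%E].

Definition hausdorff_pre (s : nat) (delta : R) (A : set 'rV[R]_n) : \bar R :=
  ereal_inf [set (\sum_(k <oo)
      (ball_volume s / 2 ^+ s)%:E * (ediam (F k) ^+ s))%E
    | F in delta_cover delta A].

(* hausdorff_pre is nonincreasing in delta, so the supremum is the limit as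
   delta tends to 0. Meant for s > 0: for s = 0 empty sets of a cover would
   contribute 1 to the sums. *)
Definition hausdorff (s : nat) (A : set 'rV[R]_n) : \bar R :=
  ereal_sup [set hausdorff_pre s delta A | delta in [set delta : R | 0 < delta]].

(* R^n with its Borel sigma-algebra. *)
Definition borel_rV := g_sigma_algebraType (@open 'rV[R]_n).

End Hausdorff.
Arguments borel_rV : clear implicits.

(* Functions on S^d and on S^d x S^d are represented by functions on the whole
   of R^(d+1), of which only the values at points of S^d are ever constrained;
   functions on [0, pi] are likewise represented by functions on R. *)
Section Sphere.
Context {R : realType} (d : nat).
Local Notation E := 'rV[R]_d.+1.
Implicit Types f g : E -> E -> R.

Definition sphere : set E := [set x | enorm x = 1].

Definition geodist (u v : E) : R := acos (dotp u v).

Definition positive_definite f : Prop :=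
  forall (n : nat) (u : 'I_n -> E) (c : 'I_n -> R),
    (forall i, sphere (u i)) ->
    0 <= \sum_(i < n) \sum_(j < n) c i * c j * f (u i) (u j).

Definition isotropic f : Prop :=
  exists fbar : R -> R,
    forall u v, sphere u -> sphere v -> f u v = fbar (geodist u v).

Definition Psi : set (R -> R) := [set psi : R -> R |
  [/\ {within `[0, pi], continuous psi},
      psi 0 = 1 &
      positive_definite (fun u v => psi (geodist u v))]].

Definition sconv_exists f g (u v : E) : Prop :=
  integrable (hausdorff d : set (borel_rV R d.+1) -> \bar R) sphere
    (fun w : borel_rV R d.+1 => (f u w * g w v)%:E).

(* Meaningful only under sconv_exists f g u v. *)
Definition sconv f g (u v : E) : R :=
  fine (\int[hausdorff d : set (borel_rV R d.+1) -> \bar R]_(w in sphere)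
    (f u w * g w v)%:E).

End Sphere.

(* Main.v *)
Require Import Defs.
From HB Require Import structures.
From mathcomp Require Import all_boot all_order all_algebra.
From mathcomp Require Import all_classical all_reals all_analysis.
From mathcomp Require Import measurable_realfun.
From mathcomp Require Import ring lra.

(** The idea is to take the positive square root of the integral operator with
    kernel [psi (geodist u v)], and to do it by an explicit iteration instead of
    spectral theory, so that the root stays a function of the geodesic distance.

    Let [X] be this kernel divided by the total measure of the sphere. As an
    operator it lies between zero and the identity: above zero because positive
    definiteness at finitely many points passes to integrals ([psd_mixed], by
    averaging over random points), below the identity by the Schur test
    ([schur_test]). The polynomials [p] defined by [p_0 = 0] and
    [p_(n+1) = p_n + (x - p_n^2) / 2] increase to the square root of [x] on
    [0, 1] and have no constant term, so [p_n(X)] is again an integral operator;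
    its kernel is [kroot n]. For a polynomial [q] that is visibly nonnegative on
    [0, 1] and vanishes at zero, the kernel of [q(X)] is nonnegative on the
    diagonal ([bernstein_diag_ge0]). Applied to
    [p_n^2 - p_m^2 - (p_n - p_m)^2 = 2 p_m (p_n - p_m)] and to
    [x - p_n^2 = 2 (p_(n+1) - p_n)], this shows that the diagonal values of
    [p_n(X)^2] are nondecreasing in [n] and bounded by those of [X], and that
    they control the distances of the rows of [kroot n] in mean square. Hence
    these rows converge in mean square to the rows of a kernel [g].

    The convolution square of [g] is the uniform limit of those of [kroot n].
    To see that it is [X], one uses the identity [x - p_n^2 = 2 (p_(n+1) - p_n)]
    again: the residuals tend to zero in mean square. They are uniformly close
    to each other and continuous, so a nonzero limit at some point would be felt
    on a spherical cap, which has positive measure ([kernel_root_exists]).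

    Everything is invariant under reflections, two of which map any pair of
    points of the sphere to any other pair at the same distance
    ([reflection_invariant_two_points]); so [g] is isotropic.

    The measure-theoretic part establishes what this needs of the Hausdorff
    measure: it is a metric outer measure, hence a measure on Borel sets
    ([borel_caratheodory]); it is invariant under isometric involutions
    ([hausdorff_preimage]); it is finite on the sphere, which is covered by
    finitely many Lipschitz graphs ([hausdorff_sphere_finite]); and it is
    positive on caps, which project onto sets containing a cube, while sets
    covering a cube have a definite total volume ([box_cover_volume],
    [hausdorff_cap_gt0]). *)

Import Order.TTheory GRing.Theory Num.Theory.
Import numFieldNormedType.Exports.

Set Implicit Arguments.
Unset Strict Implicit.
Unset Printing Implicit Defensive.

Local Open Scope classical_set_scope.
Local Open Scope ring_scope.

(** * Bounded measurable functions on a finite measure space *)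

Section BoundedMeasurable.
Context {R : realType}.

Definition bmeas d (T : measurableType d) (f : T -> R) : Prop :=
  measurable_fun setT f /\ exists M, forall x, `|f x| <= M.

Section Closure.
Context {d} {T : measurableType d}.
Implicit Types f g : T -> R.

Lemma bmeas_cst (c : R) : bmeas (fun _ : T => c).
Proof. by split; [exact: measurable_cst|exists `|c|]. Qed.

Lemma bmeasD f g : bmeas f -> bmeas g -> bmeas (fun x => f x + g x).
Proof.
move=> [mf [M fM]] [mg [N gN]]; split; first exact: measurable_funD.
by exists (M + N) => x; rewrite (le_trans (ler_normD _ _))// lerD.
Qed.

Lemma bmeasM f g : bmeas f -> bmeas g -> bmeas (fun x => f x * g x).
Proof.
move=> [mf [M fM]] [mg [N gN]]; split; first exact: measurable_funM.
by exists (M * N) => x; rewrite normrM ler_pM.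
Qed.

Lemma bmeasZ c f : bmeas f -> bmeas (fun x => c * f x).
Proof. by move=> bf; apply: bmeasM => //; exact: bmeas_cst. Qed.

Lemma bmeasB f g : bmeas f -> bmeas g -> bmeas (fun x => f x - g x).
Proof.
move=> bf bg; rewrite (_ : (fun x => _) = (fun x => f x + (-1) * g x)).
  by apply: bmeasD => //; exact: bmeasZ.
by apply/funext => x; rewrite mulN1r.
Qed.

Lemma bmeas_norm f : bmeas f -> bmeas (fun x => `|f x|).
Proof.
move=> [mf [M fM]]; split; last by exists M => x; rewrite normr_id.
exact: measurableT_comp.
Qed.

Lemma bmeas_sum (I : Type) (s : seq I) (F : I -> T -> R) :
  (forall i, bmeas (F i)) -> bmeas (fun x => \sum_(i <- s) F i x).
Proof.
move=> bF; elim: s => [|i s ih].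
  rewrite (_ : (fun x => _) = fun=> 0); first exact: bmeas_cst.
  by apply/funext => x; rewrite big_nil.
rewrite (_ : (fun x => _) = (fun x => F i x + \sum_(j <- s) F j x)).
  exact: bmeasD.
by apply/funext => x; rewrite big_cons.
Qed.

Lemma bmeas_comp d' (T' : measurableType d') (phi : T' -> T) f :
  measurable_fun setT phi -> bmeas f -> bmeas (fun x => f (phi x)).
Proof.
move=> mphi [mf [M fM]]; split; last by exists M => x; exact: fM.
exact: measurableT_comp.
Qed.

End Closure.

Section Integral.
Context {d} {T : measurableType d} (nu : {finite_measure set T -> \bar R}).
Implicit Types f g : T -> R.

Lemma bmeas_integrable f : bmeas f -> nu.-integrable setT (EFin \o f).
Proof.
move=> [mf [M fM]]; apply: measurable_bounded_integrable => //.
  by rewrite -ge0_fin_numE ?measure_ge0//; exact: fin_num_measure.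
by exists M; split; [rewrite num_real|move=> N MN x _; exact: le_trans (ltW MN)].
Qed.

Lemma bintD f g : bmeas f -> bmeas g ->
  \int[nu]_x (f x + g x) = \int[nu]_x f x + \int[nu]_x g x.
Proof. by move=> bf bg; apply: RintegralD => //; exact: bmeas_integrable. Qed.

Lemma bintB f g : bmeas f -> bmeas g ->
  \int[nu]_x (f x - g x) = \int[nu]_x f x - \int[nu]_x g x.
Proof. by move=> bf bg; apply: RintegralB => //; exact: bmeas_integrable. Qed.

Lemma bintZ c f : bmeas f -> \int[nu]_x (c * f x) = c * \int[nu]_x f x.
Proof. by move=> bf; apply: RintegralZl => //; exact: bmeas_integrable. Qed.

Lemma bint_cst c : \int[nu]_x c = c * fine (nu setT).
Proof. exact: Rintegral_cst. Qed.

Lemma bint_sum (I : Type) (s : seq I) (F : I -> T -> R) :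
  (forall i, bmeas (F i)) ->
  \int[nu]_x (\sum_(i <- s) F i x) = \sum_(i <- s) \int[nu]_x F i x.
Proof.
move=> bF; elim: s => [|i s ih].
  rewrite big_nil -[RHS](mul0r (fine (nu setT))) -bint_cst.
  by apply: eq_Rintegral => x _; rewrite big_nil.
rewrite big_cons -ih -bintD//; last exact: bmeas_sum.
by apply: eq_Rintegral => x _; rewrite big_cons.
Qed.

Lemma le_bint f g : bmeas f -> bmeas g -> (forall x, f x <= g x) ->
  \int[nu]_x f x <= \int[nu]_x g x.
Proof. by move=> bf bg fg; apply: le_Rintegral => //; exact: bmeas_integrable. Qed.

Lemma norm_bint_le f g : bmeas f -> bmeas g -> (forall x, `|f x| <= g x) ->
  `|\int[nu]_x f x| <= \int[nu]_x g x.
Proof.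
move=> bf bg fg; apply: le_trans (le_bint (bmeas_norm bf) bg fg).
by apply: le_normr_Rintegral => //; exact: bmeas_integrable.
Qed.

Lemma bint_norm_bound f M : (forall x, `|f x| <= M) -> bmeas f ->
  `|\int[nu]_x f x| <= M * fine (nu setT).
Proof. by move=> fM bf; rewrite -bint_cst norm_bint_le//; exact: bmeas_cst. Qed.

Lemma bint_EFin f : bmeas f -> (\int[nu]_x f x)%:E = (\int[nu]_x (f x)%:E)%E.
Proof.
move=> bf; rewrite /Rintegral fineK//; apply: integrable_fin_num => //.
exact: bmeas_integrable.
Qed.

(** Shifting a bounded function by a constant makes it nonnegative, which
    reduces the measurability of partial integrals to Tonelli. *)
Lemma bmeas_int d1 (T1 : measurableType d1) (f : T1 * T -> R) :
  bmeas f -> bmeas (fun x => \int[nu]_y f (x, y)).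
Proof.
move=> bf; have [mf [M fM]] := bf.
have bfx x : bmeas (fun y => f (x, y)).
  by apply: (@bmeas_comp _ _ _ _ (pair x)) => //; exact: pair1_measurable.
split; last first.
  by exists (M * fine (nu setT)) => x; apply: bint_norm_bound.
have -> : (fun x => \int[nu]_y f (x, y)) =
    fun x => fine (\int[nu]_y (f (x, y) + M)%:E)%E - M * fine (nu setT).
  apply/funext => x; rewrite -bint_EFin; last first.
    by apply: bmeasD => //; exact: bmeas_cst.
  by rewrite bintD//= ?bint_cst ?addrK//; exact: bmeas_cst.
apply: measurable_funB; last exact: measurable_cst.
apply: measurableT_comp => //.
apply: (@measurable_fun_fubini_tonelli_F _ _ _ _ _ nu
  (fun xy => (f xy + M)%:E)).
  by apply/measurable_EFinP; apply: measurable_funD => //; exact: measurable_cst.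
by move=> xy; rewrite lee_fin -lerBlDr sub0r; have := fM xy; rewrite ler_norml => /andP[].
Qed.

End Integral.

Lemma bint_swap d1 d2 (T1 : measurableType d1) (T2 : measurableType d2)
    (m1 : {finite_measure set T1 -> \bar R})
    (m2 : {finite_measure set T2 -> \bar R}) (f : T1 * T2 -> R) :
  bmeas f -> \int[m1]_x \int[m2]_y f (x, y) = \int[m2]_y \int[m1]_x f (x, y).
Proof.
move=> bf; have [mf [M fM]] := bf.
have bfx x : bmeas (fun y => f (x, y)).
  by apply: (@bmeas_comp _ _ _ _ (pair x)) => //; exact: pair1_measurable.
have bfy y : bmeas (fun x => f (x, y)).
  by apply: (@bmeas_comp _ _ _ _ (fun x => (x, y))) => //; exact: pair2_measurable.
have bfs : bmeas (fun yx : T2 * T1 => f (yx.2, yx.1)).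
  by apply: (@bmeas_comp _ _ _ _ (fun p : T2 * T1 => (p.2, p.1))) => //; exact: measurable_swap.
have bf1 := bmeas_int m2 bf.
have bf2 := bmeas_int m1 bfs.
have bM1 := @bmeas_cst _ T1 M; have bM2 := @bmeas_cst _ T2 M.
apply: (@addIr _ (M * fine (m2 setT) * fine (m1 setT))).
transitivity (\int[m1]_x \int[m2]_y (f (x, y) + M)).
  rewrite -bint_cst -bintD//; last exact: bmeas_cst.
  by apply: eq_Rintegral => x _; rewrite bintD// bint_cst.
rewrite mulrAC -bint_cst -bintD//; last exact: bmeas_cst.
transitivity (\int[m2]_y \int[m1]_x (f (x, y) + M)); last first.
  by apply: eq_Rintegral => x _; rewrite bintD// bint_cst.
have mfM : measurable_fun setT (fun xy => (f xy + M)%:E).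
  by apply/measurable_EFinP; apply: measurable_funD => //; exact: measurable_cst.
have fM0 xy : (0 <= (f xy + M)%:E)%E.
  by rewrite lee_fin -lerBlDr sub0r; have := fM xy; rewrite ler_norml => /andP[].
have := @fubini_tonelli _ _ _ _ _ m1 m2 (fun xy => (f xy + M)%:E) mfM fM0.
move/(congr1 fine).
rewrite (_ : (fun x => _) = fun x => (\int[m2]_y (f (x, y) + M))%:E); last first.
  by apply/funext => x; rewrite bint_EFin//; exact: bmeasD.
rewrite [X in _ = X -> _](_ : _ =
    fine (\int[m2]_y ((\int[m1]_x (f (x, y) + M))%:E))%E)//.
by congr fine; apply: eq_integral => y _; rewrite bint_EFin//; exact: bmeasD.
Qed.

End BoundedMeasurable.

(** * Convolution and positivity of kernels *)

Section Kernels.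
Context {R : realType} {d} {T : measurableType d}.
Variable nu : {finite_measure set T -> \bar R}.
Implicit Types (a b c k : T -> T -> R) (f : T -> R) (s : seq (R * T)).

(** Kernels are jointly measurable, so that iterated convolutions can be
    rearranged by Fubini. *)
Definition bker k : Prop := bmeas (fun p : T * T => k p.1 p.2).

Definition conv a b (u v : T) : R := \int[nu]_w (a u w * b w v).

Lemma bker_row k u : bker k -> bmeas (k u).
Proof.
move=> bk; apply: (@bmeas_comp _ _ _ _ _ (pair u) _ _ bk).
exact: pair1_measurable.
Qed.

Lemma bker_col k v : bker k -> bmeas (k^~ v).
Proof.
move=> bk; apply: (@bmeas_comp _ _ _ _ _ (pair^~ v) _ _ bk).
exact: pair2_measurable.
Qed.

Lemma bmeas_fst (f : T -> R) : bmeas f -> bmeas (fun p : T * T => f p.1).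
Proof. by move=> bf; apply: (bmeas_comp _ bf); exact: measurable_fst. Qed.

Lemma bmeas_snd (f : T -> R) : bmeas f -> bmeas (fun p : T * T => f p.2).
Proof. by move=> bf; apply: (bmeas_comp _ bf); exact: measurable_snd. Qed.

Lemma bker_swap k : bker k -> bker (fun u v => k v u).
Proof.
move=> bk; apply: (@bmeas_comp _ _ _ _ _ (fun p : T * T => (p.2, p.1)) _ _ bk).
exact: measurable_swap.
Qed.

Lemma bker_mul a b u v : bker a -> bker b -> bmeas (fun w => a u w * b w v).
Proof. by move=> ba bb; apply: bmeasM; [exact: bker_row|exact: bker_col]. Qed.

Lemma bker_conv a b : bker a -> bker b -> bker (conv a b).
Proof.
move=> ba bb.
apply: (@bmeas_int _ _ _ nu _ _ (fun q : (T * T) * T => a q.1.1 q.2 * b q.2 q.1.2)).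
have m1 : measurable_fun setT (fun q : (T * T) * T => (q.1.1, q.2)).
  by apply: measurable_fun_pair => //; exact: measurableT_comp.
have m2 : measurable_fun setT (fun q : (T * T) * T => (q.2, q.1.2)).
  by apply: measurable_fun_pair => //; exact: measurableT_comp.
by apply: bmeasM; [exact: (bmeas_comp m1 ba)|exact: (bmeas_comp m2 bb)].
Qed.

Lemma convA a b c u v : bker a -> bker b -> bker c ->
  conv (conv a b) c u v = conv a (conv b c) u v.
Proof.
move=> ba bb bc.
have bj : bmeas (fun p : T * T => a u p.2 * b p.2 p.1 * c p.1 v).
  apply: bmeasM; last exact: (bmeas_fst (bker_col v bc)).
  by apply: bmeasM; [exact: (bmeas_snd (bker_row u ba))|exact: (bker_swap bb)].
transitivity (\int[nu]_w \int[nu]_z (a u z * b z w * c w v)).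
  apply: eq_Rintegral => w _; rewrite mulrC -bintZ; last exact: bker_mul.
  by apply: eq_Rintegral => z _; rewrite mulrC.
rewrite (bint_swap nu nu bj); apply: eq_Rintegral => z _ /=.
rewrite -bintZ; last exact: bker_mul.
by apply: eq_Rintegral => w _; rewrite mulrA.
Qed.

Definition quad k s : R := \sum_(p <- s) \sum_(q <- s) p.1 * q.1 * k p.2 q.2.

Definition psd k : Prop := forall s, 0 <= quad k s.

Definition ksym k : Prop := forall u v, k u v = k v u.

Lemma quad_cons k (x : R) w s : ksym k -> quad k ((x, w) :: s) =
  x ^+ 2 * k w w + 2 * (\sum_(q <- s) q.1 * (x * k q.2 w)) + quad k s.
Proof.
move=> ks; rewrite /quad big_cons big_cons /=.
under [X in _ + X]eq_bigr do rewrite big_cons /=.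
rewrite big_split /= expr2 -!addrA; congr (_ + _).
rewrite addrA; congr (_ + _).
rewrite mulr_natl mulr2n; congr (_ + _); apply: eq_bigr => q _.
  by rewrite ks; ring.
by ring.
Qed.

Section IntegratedPositivity.
Variables (k : T -> T -> R) (f : T -> R).
Hypotheses (bk : bker k) (ks : ksym k) (kpsd : psd k) (bf : bmeas f).
Let mass := fine (nu setT).
Let kf u := \int[nu]_w (k u w * f w).
Let A s := \sum_(p <- s) p.1 * kf p.2.
Let B := \int[nu]_w (f w * kf w).
Let C := \int[nu]_w (f w ^+ 2 * k w w).

Let bkf : bmeas kf.
Proof.
apply: (@bmeas_int _ _ _ nu _ _ (fun p : T * T => k p.1 p.2 * f p.2)).
by apply: bmeasM => //; exact: bmeas_snd.
Qed.

Let bdiag : bmeas (fun w => k w w).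
Proof.
apply: (@bmeas_comp _ _ _ _ _ (fun w : T => (w, w)) _ _ bk).
exact: measurable_fun_pair.
Qed.

(** The left-hand side is the expectation of the quadratic form of [k] at the
    points of [s] together with [n] independent points of law [nu / mass], a
    point [w] being weighted by [mass * f w]. *)
Lemma quad_random_points n s : 0 < mass ->
  0 <= quad k s + 2 * n%:R * A s + n%:R * (n%:R - 1) * B + n%:R * mass * C.
Proof.
move=> m0; elim: n s => [|n ih] s.
  by rewrite !(mulr0, mul0r) !addr0.
have bterm (q : R * T) : bmeas (fun w => q.1 * (mass * f w * k q.2 w)).
  apply: bmeasZ; apply: bmeasM; first exact: bmeasZ.
  exact: bker_row.
have bq1 : bmeas (fun w => (mass * f w) ^+ 2 * k w w).
  rewrite (_ : (fun w => _) = fun w => (mass ^+ 2 * f w) * (f w * k w w)).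
    by apply: bmeasM; [exact: bmeasZ|exact: bmeasM].
  by apply/funext => w; ring.
have bq2 : bmeas (fun w => 2 * (\sum_(q <- s) q.1 * (mass * f w * k q.2 w))).
  by apply: bmeasZ; exact: bmeas_sum.
have ba : bmeas (fun w => mass * f w * kf w + A s).
  by apply: bmeasD; [apply: bmeasM => //; exact: bmeasZ|exact: bmeas_cst].
(* The inequality for [n] points and [s] enlarged by [w], to be averaged in [w]. *)
pose h w := (mass * f w) ^+ 2 * k w w +
  2 * (\sum_(q <- s) q.1 * (mass * f w * k q.2 w)) +
  2 * n%:R * (mass * f w * kf w + A s) +
  (quad k s + n%:R * (n%:R - 1) * B + n%:R * mass * C).
have h0 w : 0 <= h w.
  have := ih ((mass * f w, w) :: s); rewrite quad_cons// /A big_cons /= -/(A s).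
  by rewrite /h; congr (0 <= _); ring.
have : 0 <= \int[nu]_w h w by apply: Rintegral_ge0.
rewrite /h bintD; [|by apply: bmeasD; [exact: bmeasD|exact: bmeasZ]|exact: bmeas_cst].
rewrite (bintD _ (bmeasD bq1 bq2) (bmeasZ (2 * n%:R) ba)) (bintD _ bq1 bq2).
rewrite bint_cst -/mass.
rewrite bintZ; last exact: bmeas_sum.
rewrite bint_sum// (bintZ _ _ ba).
rewrite bintD; [|by apply: bmeasM => //; exact: bmeasZ|exact: bmeas_cst].
rewrite bint_cst -/mass.
have -> : \int[nu]_w ((mass * f w) ^+ 2 * k w w) = mass ^+ 2 * C.
  rewrite -bintZ; last by apply: bmeasM => //; exact: bmeasM.
  by apply: eq_Rintegral => w _; ring.
have -> : \int[nu]_w (mass * f w * kf w) = mass * B.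
  rewrite -bintZ; last exact: bmeasM.
  by apply: eq_Rintegral => w _; rewrite mulrA.
have -> : \sum_(q <- s) \int[nu]_w (q.1 * (mass * f w * k q.2 w)) = mass * A s.
  rewrite mulr_sumr; apply: eq_bigr => q _.
  rewrite mulrCA -bintZ; last by apply: bmeasM => //; exact: bker_row.
  rewrite -bintZ; last by apply: bmeasZ; apply: bmeasM => //; exact: bker_row.
  by apply: eq_Rintegral => w _; ring.
rewrite (_ : _ + _ = mass * (quad k s + 2 * n.+1%:R * A s +
    n.+1%:R * (n.+1%:R - 1) * B + n.+1%:R * mass * C)); last first.
  by rewrite -natr1; ring.
by rewrite pmulr_rge0.
Qed.

(** Positivity against finitely many point masses extends to point masses
    plus a density: [n] points of weight [1 / n] approximate the density, and
    their diagonal contribution vanishes as [n] grows. *)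
Lemma psd_mixed (c : R) u : 0 < mass ->
  0 <= c ^+ 2 * k u u + 2 * c * kf u + B.
Proof.
move=> m0; set x := (X in 0 <= X).
have key n : B - mass * C <= n.+1%:R * x.
  (* Scaling the point mass by [n] keeps it in balance with the [n] random points. *)
  have := quad_random_points n.+1 [:: (n.+1%:R * c, u)] m0.
  rewrite quad_cons// /quad !big_nil /A big_cons big_nil /=.
  set N := n.+1%:R => H.
  have N0 : 0 < N by rewrite /N.
  rewrite -subr_ge0 -(pmulr_rge0 _ N0); apply: le_trans H _.
  by rewrite /x le_eqVlt; apply/orP; left; apply/eqP; ring.
rewrite leNgt; apply/negP => x0.
have := key (Num.bound ((mass * C - B) / - x)).
have /ltW := archi_boundP (normr_ge0 ((mass * C - B) / - x)).
set N := Num.bound _; set M := Num.bound _ => HN.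
have HM : (mass * C - B) / - x < M%:R.
  have [y0|y0] := leP 0 ((mass * C - B) / - x); first exact: archi_boundP.
  exact: lt_le_trans y0 _.
rewrite ltr_pdivrMr ?oppr_gt0// in HM.
have : M.+1%:R * x <= M%:R * x by rewrite -natr1 mulrDl mul1r gerDl ltW.
lra.
Qed.

End IntegratedPositivity.

(** The Schur test, from [2 |k w z f w f z| <= |k w z| (f w ^+ 2 + f z ^+ 2)]
    and the bound on the rows of [k] after exchanging the integrals. *)
Lemma schur_test k f : bker k -> ksym k -> bmeas f ->
  (forall u, \int[nu]_w `|k u w| <= 1) ->
  \int[nu]_w (f w * \int[nu]_z (k w z * f z)) <= \int[nu]_w (f w ^+ 2).
Proof.
move=> bk ks bf k1.
have bf2 : bmeas (fun w => f w ^+ 2) by exact: bmeasM.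
have bkn : bmeas (fun p : T * T => `|k p.1 p.2|) by exact: bmeas_norm.
have bkr w : bmeas (k w) by exact: bker_row.
have bkrn w : bmeas (fun z => `|k w z|) by exact: bmeas_norm.
have b1 : bmeas (fun w => f w ^+ 2 * \int[nu]_z `|k w z|).
  by apply: bmeasM => //; exact: (bmeas_int nu bkn).
have bj2 : bmeas (fun p : T * T => `|k p.1 p.2| * f p.2 ^+ 2).
  by apply: bmeasM => //; exact: (bmeas_snd bf2).
have b2 := bmeas_int nu bj2.
have E2 : \int[nu]_w \int[nu]_z (`|k w z| * f z ^+ 2) =
    \int[nu]_w (f w ^+ 2 * \int[nu]_z `|k w z|).
  rewrite (bint_swap nu nu bj2) /=; apply: eq_Rintegral => z _.
  rewrite -bintZ//; apply: eq_Rintegral => w _; by rewrite mulrC ks.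
have le1 : \int[nu]_w (f w ^+ 2 * \int[nu]_z `|k w z|) <= \int[nu]_w (f w ^+ 2).
  by apply: le_bint => // w; rewrite ler_piMr// sqr_ge0.
apply: (@le_trans _ _ (\int[nu]_w (2^-1 * (f w ^+ 2 * \int[nu]_z `|k w z| +
    \int[nu]_z (`|k w z| * f z ^+ 2))))); last first.
  rewrite bintZ; last exact: bmeasD.
  by rewrite bintD// E2; lra.
apply: le_bint.
- apply: bmeasM => //.
  apply: (@bmeas_int _ _ _ nu _ _ (fun p : T * T => k p.1 p.2 * f p.2)).
  by apply: bmeasM => //; exact: bmeas_snd.
- by apply: bmeasZ; exact: bmeasD.
move=> w.
have bw2 : bmeas (fun z => `|k w z| * f z ^+ 2) by exact: bmeasM.
rewrite -!bintZ//; last exact: bmeasM.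
rewrite -bintD//; last exact: bmeasZ.
rewrite -bintZ; last by apply: bmeasD => //; exact: bmeasZ.
apply: le_bint => [||z].
- by apply: bmeasZ; exact: bmeasM.
- by apply: bmeasZ; apply: bmeasD => //; exact: bmeasZ.
rewrite (_ : 2^-1 * _ = `|k w z| * ((f w ^+ 2 + f z ^+ 2) / 2)); last by field.
apply: (le_trans (ler_norm _)); rewrite mulrCA normrM ler_wpM2l//.
rewrite ler_norml; apply/andP; split.
- have := sqr_ge0 (f w + f z); rewrite sqrrD; lra.
- have := sqr_ge0 (f w - f z); rewrite sqrrB; lra.
Qed.

End Kernels.

Section PsdKernels.
Context {R : realType} {d} {T : measurableType d}.
Variable k : T -> T -> R.
Hypotheses (ks : ksym k) (kpsd : psd k).

Lemma psd_diag_ge0 u : 0 <= k u u.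
Proof.
have := kpsd [:: (1, u)].
by rewrite quad_cons// /quad !big_nil expr1n mul1r mulr0 !addr0.
Qed.

(** Cauchy-Schwarz between the point [z] and the difference of [w] and [v]. *)
Lemma psd_modulus z w v :
  (k z w - k z v) ^+ 2 <= k z z * (k w w + k v v - 2 * k w v).
Proof.
have H t : 0 <= t ^+ 2 * k z z + 2 * t * (k z w - k z v) +
    (k w w + k v v - 2 * k w v).
  have := kpsd [:: (t, z); (1, w); (-1, v)].
  rewrite !quad_cons// /quad !big_cons !big_nil /= (ks w z) (ks v z) (ks v w).
  by congr (0 <= _); ring.
set b := k z w - k z v in H *; set c := _ - 2 * k w v in H *.
have [z0|znz] := eqVneq (k z z) 0.
  rewrite z0 mul0r; have := H (- (c + 1) / (2 * b)).
  have [->|b0] := eqVneq b 0; first by rewrite expr0n.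
  rewrite z0 mulr0 add0r (_ : 2 * _ * b = - (c + 1)); last by field.
  by lra.
have zp : 0 < k z z by rewrite lt_def znz psd_diag_ge0.
have := H (- b / k z z).
rewrite (_ : _ + _ + c = c - b ^+ 2 / k z z); last by field.
by rewrite subr_ge0 ler_pdivrMr// mulrC.
Qed.

End PsdKernels.

(** * Polynomials in a kernel and the square root iteration *)

Section KernelPolynomials.
Context {R : realType} {d} {T : measurableType d}.
Variables (nu : {finite_measure set T -> \bar R}) (X : T -> T -> R).
Implicit Types (p q r s : {poly R}).

Fixpoint kpow (n : nat) : T -> T -> R :=
  if n is n'.+1 then conv nu X (kpow n') else X.

(** The polynomial [r] stands for the operator [X r(X)]: the missing constant
    term is what makes it an integral operator. *)
Definition kpoly r (u v : T) : R := \sum_(i < size r) r`_i * kpow i u v.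

Lemma kpoly_widen n r u v : (size r <= n)%N ->
  kpoly r u v = \sum_(i < n) r`_i * kpow i u v.
Proof.
move=> rn; rewrite /kpoly (big_ord_widen _ (fun i => r`_i * kpow i u v) rn).
rewrite big_mkcond; apply: eq_bigr => i _; case: ifPn => //.
by rewrite -leqNgt => ri; rewrite nth_default// mul0r.
Qed.

Lemma kpolyD p q u v : kpoly (p + q) u v = kpoly p u v + kpoly q u v.
Proof.
rewrite (kpoly_widen _ _ (size_polyD p q)).
rewrite (kpoly_widen _ _ (leq_maxl (size p) (size q))).
rewrite (kpoly_widen _ _ (leq_maxr (size p) (size q))) -big_split.
by apply: eq_bigr => i _; rewrite coefD mulrDl.
Qed.

Lemma kpolyZ c p u v : kpoly (c *: p) u v = c * kpoly p u v.
Proof.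
rewrite (kpoly_widen _ _ (size_scale_leq c p)) mulr_sumr.
by apply: eq_bigr => i _; rewrite coefZ mulrA.
Qed.

Lemma kpolyCM c p u v : kpoly (c%:P * p) u v = c * kpoly p u v.
Proof. by rewrite mul_polyC kpolyZ. Qed.

Lemma kpolyB p q u v : kpoly (p - q) u v = kpoly p u v - kpoly q u v.
Proof. by rewrite -scaleN1r kpolyD kpolyZ mulN1r. Qed.

Lemma kpoly0 u v : kpoly 0 u v = 0.
Proof. by rewrite /kpoly size_poly0 big_ord0. Qed.

Lemma kpoly_sum I (s : seq I) (F : I -> {poly R}) u v :
  kpoly (\sum_(i <- s) F i) u v = \sum_(i <- s) kpoly (F i) u v.
Proof.
elim: s => [|i s ih]; first by rewrite !big_nil kpoly0.
by rewrite !big_cons kpolyD ih.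
Qed.

Lemma kpolyC c u v : kpoly c%:P u v = c * X u v.
Proof.
by rewrite (kpoly_widen _ _ (size_polyC_leq1 c)) big_ord_recl big_ord0 coefC addr0.
Qed.

Lemma kpoly1 u v : kpoly 1 u v = X u v.
Proof. by rewrite -[1]/(1%:P) kpolyC mul1r. Qed.

Hypothesis bX : bker X.

Lemma bker_kpow n : bker (kpow n).
Proof. by elim: n => [//|n ih]; exact: bker_conv. Qed.

Lemma bker_kpoly r : bker (kpoly r).
Proof. by apply: bmeas_sum => i; apply: bmeasZ; exact: bker_kpow. Qed.

Lemma kpolyXM p u v : kpoly ('X * p) u v = conv nu X (kpoly p) u v.
Proof.
have sXp : (size ('X * p)%R <= (size p).+1)%N.
  by apply: leq_trans (size_polyMleq _ _) _; rewrite size_polyX.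
rewrite (kpoly_widen _ _ sXp) big_ord_recl coefXM mul0r add0r.
transitivity (\int[nu]_w \sum_(i < size p) p`_i * (X u w * kpow i w v)).
  rewrite bint_sum; last first.
    by move=> i; apply: bmeasZ; apply: bker_mul => //; exact: bker_kpow.
  apply: eq_bigr => i _; rewrite coefXM /= bintZ//.
  by apply: bker_mul => //; exact: bker_kpow.
apply: eq_Rintegral => w _; rewrite mulr_sumr; apply: eq_bigr => i _.
by rewrite mulrCA.
Qed.

(** The convolution of kernels is the composition of operators, and it
    compensates the factor [X] carried by both sides. *)
Lemma kpolyM p q u v : conv nu (kpoly p) (kpoly q) u v = kpoly ('X * (p * q)) u v.
Proof.
elim/poly_ind: p u v => [|p c ih] u v.
  rewrite mul0r mulr0 kpoly0 /conv -[RHS](mul0r (fine (nu setT))) -bint_cst.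
  by apply: eq_Rintegral => w _; rewrite kpoly0 mul0r.
transitivity (conv nu (conv nu X (kpoly p)) (kpoly q) u v +
    c * conv nu X (kpoly q) u v).
  have b1 : bmeas (fun w => conv nu X (kpoly p) u w * kpoly q w v).
    by apply: bker_mul; [apply: bker_conv|]; rewrite ?bX//; exact: bker_kpoly.
  have b2 : bmeas (fun w => X u w * kpoly q w v).
    by apply: bker_mul => //; exact: bker_kpoly.
  rewrite -bintZ// -bintD//; last exact: bmeasZ.
  apply: eq_Rintegral => w _.
  by rewrite kpolyD kpolyC mulrC -(mulrC 'X) kpolyXM; ring.
rewrite convA//; [|exact: bker_kpoly|exact: bker_kpoly].
rewrite -kpolyXM -kpolyCM -(_ : kpoly ('X * ('X * (p * q))) u v =
  conv nu X (conv nu (kpoly p) (kpoly q)) u v); last first.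
  by rewrite kpolyXM; apply: eq_Rintegral => w _; rewrite ih.
by rewrite -kpolyD; congr kpoly; ring.
Qed.

Hypothesis Xsym : ksym X.

Lemma kpoly_sym r : ksym (kpoly r).
Proof.
move=> u v; elim/poly_ind: r u v => [|p c ih] u v; first by rewrite !kpoly0.
rewrite !kpolyD !kpolyC Xsym; congr (_ + _).
transitivity (conv nu (kpoly p) (kpoly 1) u v).
  by rewrite kpolyM mulr1 mulrC.
transitivity (conv nu (kpoly 1) (kpoly p) v u); last first.
  by rewrite kpolyM mul1r mulrC.
by apply: eq_Rintegral => w _; rewrite mulrC ih !kpoly1 Xsym.
Qed.

Lemma kpoly_sqr s u : kpoly ('X * (s * s)) u u = \int[nu]_w (kpoly s u w) ^+ 2.
Proof.
rewrite -kpolyM; apply: eq_Rintegral => w _.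
by rewrite [kpoly s w u]kpoly_sym expr2.
Qed.

Lemma kpoly_quadratic s u : kpoly ('X * ('X * (s * s))) u u =
  \int[nu]_w (kpoly s u w * \int[nu]_z (X w z * kpoly s u z)).
Proof.
have -> : 'X * (s * s) = s * ('X * s) by ring.
rewrite -kpolyM; apply: eq_Rintegral => w _.
rewrite kpolyXM; congr (_ * _); apply: eq_Rintegral => z _.
by rewrite [kpoly s z u]kpoly_sym.
Qed.

Lemma kpoly_invariant (g : T -> T) r u v : measurable_fun setT g ->
  (forall f : T -> R, bmeas f -> \int[nu]_w f (g w) = \int[nu]_w f w) ->
  (forall u v, X (g u) (g v) = X u v) ->
  kpoly r (g u) (g v) = kpoly r u v.
Proof.
move=> mg ig Xg; apply: eq_bigr => i _; congr (_ * _).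
elim: (nat_of_ord i) u v => [//|n ih] u v /=.
rewrite -[LHS]ig; last by apply: bker_mul => //; exact: bker_kpow.
by apply: eq_Rintegral => w _; rewrite Xg ih.
Qed.

Hypothesis Xpsd : psd X.
Hypothesis nu_gt0 : 0 < fine (nu setT).
Hypothesis Xcontr : forall u, \int[nu]_w `|X u w| <= 1.

Section Diagonal.
Variable u : T.

(** With [s = c + x t], the operator [x s(x)^2] is tested against the point mass
    [c] at [u] plus the density [t(X)(u, _)]. *)
Lemma kpoly_diag_sqr_ge0 s : 0 <= kpoly (s * s) u u.
Proof.
elim/poly_ind: s => [|t c _]; first by rewrite mul0r kpoly0.
have bt : bmeas (fun w => kpoly t u w) by exact/bker_row/bker_kpoly.
have := psd_mixed bX Xsym Xpsd bt c u nu_gt0.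
have -> : (t * 'X + c%:P) * (t * 'X + c%:P) = (c ^+ 2)%:P +
    ((2 * c)%:P * ('X * t) + 'X * ('X * (t * t))).
  by rewrite expr2 !polyCM rmorph_nat; ring.
rewrite !kpolyD kpolyC kpolyCM kpoly_quadratic kpolyXM addrA.
congr (0 <= _ + _ * _ + _); apply: eq_Rintegral => w _.
by rewrite kpoly_sym.
Qed.

Lemma kpoly_diag_Xsqr_ge0 s : 0 <= kpoly ('X * (s * s)) u u.
Proof. by rewrite kpoly_sqr; apply: Rintegral_ge0 => w _; exact: sqr_ge0. Qed.

Lemma kpoly_diag_XBsqr_ge0 s : 0 <= kpoly ('X * ((1 - 'X) * (s * s))) u u.
Proof.
have -> : 'X * ((1 - 'X) * (s * s)) = 'X * (s * s) - 'X * ('X * (s * s)) by ring.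
rewrite kpolyB kpoly_sqr kpoly_quadratic subr_ge0.
by apply: schur_test => //; exact/bker_row/bker_kpoly.
Qed.

Lemma kpoly_diag_Bsqr_ge0 s : 0 <= kpoly ((1 - 'X) * (s * s)) u u.
Proof.
have -> : (1 - 'X) * (s * s) = ((1 - 'X) * s) * ((1 - 'X) * s) +
  'X * ((1 - 'X) * (s * s)) by ring.
by rewrite kpolyD addr_ge0// ?kpoly_diag_sqr_ge0// kpoly_diag_XBsqr_ge0.
Qed.

(** An even power is a square and an odd one is [1 - x] times a square; the
    positivity of [(1 - x) s^2] comes from
    [(1 - x) s^2 = ((1 - x) s)^2 + x (1 - x) s^2]. *)
Lemma kpoly_diag_Bpow_ge0 j : 0 <= kpoly ((1 - 'X) ^+ j) u u /\
  0 <= kpoly ('X * (1 - 'X) ^+ j) u u.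
Proof.
rewrite -(odd_double_half j) exprD -addnn exprD.
case: odd; rewrite ?expr1 ?expr0 ?mul1r.
  by split; [exact: kpoly_diag_Bsqr_ge0|exact: kpoly_diag_XBsqr_ge0].
by split; [exact: kpoly_diag_sqr_ge0|exact: kpoly_diag_Xsqr_ge0].
Qed.

End Diagonal.
End KernelPolynomials.

Section SquareRootIteration.
Context {R : realType}.
Implicit Types p q : {poly R}.

(** Nonnegativity on [0, 1] in a form that is visibly stable under sums and
    products, and that suffices for the iteration below. *)
Definition bernstein p : Prop :=
  exists2 q : {poly R}, (forall i, 0 <= q`_i) & p = q \Po (1 - 'X).

Lemma bernsteinD p q : bernstein p -> bernstein q -> bernstein (p + q).
Proof.
move=> [p' hp ->] [q' hq ->]; exists (p' + q'); first by move=> i; rewrite coefD addr_ge0.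
by rewrite comp_polyD.
Qed.

Lemma bernsteinM p q : bernstein p -> bernstein q -> bernstein (p * q).
Proof.
move=> [p' hp ->] [q' hq ->]; exists (p' * q').
  by move=> i; rewrite coefM sumr_ge0// => j _; rewrite mulr_ge0.
by rewrite comp_polyM.
Qed.

Lemma bernsteinC (c : R) : 0 <= c -> bernstein c%:P.
Proof.
by move=> c0; exists c%:P; rewrite ?comp_polyC// => i; rewrite coefC; case: eqP.
Qed.

Lemma bernstein_1BX : bernstein (1 - 'X).
Proof. by exists 'X; rewrite ?comp_polyX// => i; rewrite coefX ler0n. Qed.

Let h : {poly R} := (2^-1)%:P.

Let hh : h + h = 1.
Proof. by rewrite /h -polyCD -[1 in RHS]/(1%:P); congr _%:P; field. Qed.

Let bh : bernstein h. Proof. by apply: bernsteinC. Qed.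

(** With [p = x * sqrt_iter n] this is the iteration [p := p + (x - p^2) / 2],
    started from zero, which increases to the square root of [x] on [0, 1].
    The factor [x] is taken out to fit the encoding of [kpoly]. *)
Fixpoint sqrt_iter (n : nat) : {poly R} :=
  if n is n'.+1
  then sqrt_iter n' + h * (1 - 'X * (sqrt_iter n' * sqrt_iter n')) else 0.

Let sqrt_iterS n : sqrt_iter n.+1 =
  sqrt_iter n + h * (1 - 'X * (sqrt_iter n * sqrt_iter n)).
Proof. by []. Qed.

Let defect n : {poly R} := 1 - 'X * sqrt_iter n.

(** [1 - p] evolves by [q := ((1 - x) + q^2) / 2]. *)
Let bernstein_defect n : bernstein (defect n).
Proof.
elim: n => [|n ih]; first by rewrite /defect mulr0 subr0; exact: (bernsteinC ler01).
suff -> : defect n.+1 = h * ((1 - 'X) + defect n * defect n).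
  apply: bernsteinM => //; apply: bernsteinD; first exact: bernstein_1BX.
  exact: bernsteinM.
rewrite /defect /=; set r := sqrt_iter n.
transitivity ((h + h) * (1 - 'X * r) - h * ('X * (1 - 'X * (r * r)))).
  by rewrite hh; ring.
by ring.
Qed.

(** Consecutive steps differ by the factor [(q + q') / 2], where [q] and [q']
    are the two values of [1 - x * sqrt_iter n]. *)
Lemma bernstein_sqrt_iter_step n : bernstein (sqrt_iter n.+1 - sqrt_iter n).
Proof.
elim: n => [|n ih].
  by rewrite /= mulr0 mulr0 subr0 subr0 add0r mulr1.
suff -> : sqrt_iter n.+2 - sqrt_iter n.+1 =
    (sqrt_iter n.+1 - sqrt_iter n) * (h * (defect n + defect n.+1)).
  apply: bernsteinM => //; apply: bernsteinM => //.
  by apply: bernsteinD; exact: bernstein_defect.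
rewrite [sqrt_iter n.+2]sqrt_iterS /defect.
set a := sqrt_iter n; set b := sqrt_iter n.+1.
have eb : b - a = h * (1 - 'X * (a * a)) by rewrite /b sqrt_iterS addrC addKr.
transitivity ((h + h) * (b - a) - h * ('X * (b - a) * (a + b))); last by ring.
rewrite hh mul1r addrAC subrr add0r.
transitivity (h * (1 - 'X * (a * a)) - h * ('X * (b - a) * (a + b))).
  by ring.
by rewrite -eb.
Qed.

Lemma bernstein_sqrt_iterB m n : (m <= n)%N ->
  bernstein (sqrt_iter n - sqrt_iter m).
Proof.
move=> /subnKC <-; elim: (n - m)%N => [|k ih].
  by rewrite addn0 subrr; exact: (bernsteinC (lexx _)).
rewrite addnS -(subrK (sqrt_iter (m + k)) (sqrt_iter _)) -addrA.
by apply: bernsteinD => //; exact: bernstein_sqrt_iter_step.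
Qed.

Lemma bernstein_sqrt_iter n : bernstein (sqrt_iter n).
Proof. by have := bernstein_sqrt_iterB (leq0n n); rewrite subr0. Qed.

(** The residual of an iterate is twice the next step, so the convergence of the
    iterates already forces the residuals to zero. *)
Lemma sqrt_iter_residual n : 1 - 'X * (sqrt_iter n * sqrt_iter n) =
  2%:P * (sqrt_iter n.+1 - sqrt_iter n).
Proof.
rewrite sqrt_iterS (addrC (sqrt_iter n)) addrK (mulrA 2%:P).
suff -> : 2%:P * h = 1 by rewrite mul1r.
by rewrite /h -polyCM divff.
Qed.

End SquareRootIteration.

Section KernelSquareRoot.
Context {R : realType} {d} {T : measurableType d}.
Variables (nu : {finite_measure set T -> \bar R}) (X : T -> T -> R).
Hypotheses (bX : bker X) (Xsym : ksym X) (Xpsd : psd X).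
Hypothesis nu_gt0 : 0 < fine (nu setT).
Hypothesis Xcontr : forall u, \int[nu]_w `|X u w| <= 1.

(** The diagonal values of kernel polynomials are a positive functional on
    polynomials, a substitute for the spectral measure of [X] at [u]. *)
Lemma bernstein_diag_ge0 (p : {poly R}) u : bernstein p ->
  0 <= kpoly nu X p u u /\ 0 <= kpoly nu X ('X * p) u u.
Proof.
move=> [q q0 ->]; rewrite comp_polyE mulr_sumr !kpoly_sum.
split; apply: sumr_ge0 => i _; rewrite -?scalerAr kpolyZ; apply: mulr_ge0 => //.
  by apply: (kpoly_diag_Bpow_ge0 bX Xsym Xpsd nu_gt0 Xcontr u _).1.
by apply: (kpoly_diag_Bpow_ge0 bX Xsym Xpsd nu_gt0 Xcontr u _).2.
Qed.

Definition kroot n : T -> T -> R := kpoly nu X (sqrt_iter n).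

Lemma bker_kroot n : bker (kroot n).
Proof. exact: bker_kpoly. Qed.

Lemma kroot_sym n : ksym (kroot n).
Proof. exact: kpoly_sym. Qed.

(** The squared mean-square norm of the row [u] of [kroot n]. *)
Definition kroot_energy n u : R := conv nu (kroot n) (kroot n) u u.

Lemma kroot_energyE n u : kroot_energy n u = \int[nu]_w (kroot n u w) ^+ 2.
Proof. by rewrite /kroot_energy kpolyM// kpoly_sqr. Qed.

(** [(a - b)^2 <= a^2 - b^2] because [b (a - b) >= 0]: bounded monotone energies
    make the rows of the iterates a Cauchy sequence in mean square. *)
Lemma kroot_diff_le m n u : (m <= n)%N ->
  \int[nu]_w (kroot n u w - kroot m u w) ^+ 2 <=
  kroot_energy n u - kroot_energy m u.
Proof.
move=> mn; rewrite /kroot_energy /kroot.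
set p := sqrt_iter n; set q := sqrt_iter m.
rewrite (_ : \int[nu]_w _ = kpoly nu X ('X * ((p - q) * (p - q))) u u); last first.
  by rewrite kpoly_sqr//; apply: eq_Rintegral => w _; rewrite kpolyB.
rewrite !kpolyM// -kpolyB -subr_ge0 -kpolyB.
have -> : 'X * (p * p) - 'X * (q * q) - 'X * ((p - q) * (p - q)) =
  'X * (2%:P * (q * (p - q))) by rewrite rmorph_nat; ring.
apply: (bernstein_diag_ge0 u _).2.
apply: bernsteinM; first exact: bernsteinC.
by apply: bernsteinM; [exact: bernstein_sqrt_iter|exact: bernstein_sqrt_iterB].
Qed.

Lemma kroot_residual n u v :
  X u v - conv nu (kroot n) (kroot n) u v = 2 * (kroot n.+1 u v - kroot n u v).
Proof.
by rewrite kpolyM// -(kpoly1 nu X) -kpolyB sqrt_iter_residual kpolyCM kpolyB.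
Qed.

Lemma kroot_energy_le n u : kroot_energy n u <= X u u.
Proof.
rewrite -subr_ge0 kroot_residual -kpolyB mulr_ge0//.
exact: (bernstein_diag_ge0 u (bernstein_sqrt_iter_step n)).1.
Qed.

End KernelSquareRoot.

(** * Limits in mean square *)

Section MeanSquare.
Context {R : realType} {d} {T : measurableType d}.
Variable nu : {finite_measure set T -> \bar R}.
Implicit Types (f g : T -> R).

Lemma limn_einf_le_bound (u : (\bar R)^nat) (c : \bar R) :
  (forall n, (u n <= c)%E) -> (limn_einf u <= c)%E.
Proof.
move=> uc; apply: le_trans (limn_einf_sup u) _.
rewrite limn_esup_lim; apply: lime_le; first exact: is_cvg_esups.
by apply: nearW => n; apply: ge_ereal_sup => _ [m _ <-].
Qed.

Section Completeness.
Variable h : nat -> T -> R.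
Hypothesis bh : forall k, bmeas (h k).
Hypothesis hCauchy : forall k j, (k <= j)%N ->
  \int[nu]_x (h j x - h k x) ^+ 2 <= (2^-1 ^+ k) ^+ 2.

Let step (k : nat) (x : T) : R := `|h k.+1 x - h k x|.

Let bstep k : bmeas (step k).
Proof. by apply: bmeas_norm; exact: bmeasB. Qed.

(** [|y| <= (e + y^2 / e) / 2] with [e = 2^-k] replaces the Cauchy-Schwarz
    inequality. *)
Let int_step_le k :
  \int[nu]_x step k x <= 2 * (fine (nu setT) + 1) / 2 ^+ k.+1.
Proof.
set e : R := 2^-1 ^+ k.
have e0 : 0 < e by rewrite exprn_gt0.
have bd : bmeas (fun x => (h k.+1 x - h k x) ^+ 2).
  by apply: bmeasM; exact: bmeasB.
have bde : bmeas (fun x => e + e^-1 * (h k.+1 x - h k x) ^+ 2).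
  by apply: bmeasD; [exact: bmeas_cst|exact: bmeasZ].
apply: (@le_trans _ _ (\int[nu]_x (e + e^-1 * (h k.+1 x - h k x) ^+ 2))).
  apply: le_bint => // x; rewrite /step.
  set y := h k.+1 x - h k x; rewrite -(real_normK (num_real y)).
  have : 0 <= e^-1 * (`|y| - e) ^+ 2 + `|y|.
    by rewrite addr_ge0// mulr_ge0 ?sqr_ge0// invr_ge0 ltW.
  suff -> : e^-1 * (`|y| - e) ^+ 2 + `|y| = e^-1 * `|y| ^+ 2 + e - `|y| by lra.
  by field; rewrite gt_eqF.
rewrite bintD//; [|exact: bmeas_cst|exact: bmeasZ].
rewrite bint_cst bintZ//.
have H := hCauchy (leqnSn k).
have -> : 2 * (fine (nu setT) + 1) / 2 ^+ k.+1 = e * fine (nu setT) + e.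
  by rewrite /e exprS exprVn; field; rewrite expf_neq0.
rewrite lerD2l -ler_pdivlMl ?invr_gt0// invrK.
by apply: le_trans H _; rewrite -/e expr2.
Qed.

(** The increments are summable in mean, hence summable almost everywhere. *)
Lemma cauchy_ae_cvg : {ae nu, forall x, cvgn (h ^~ x)}.
Proof.
have int_series : (\int[nu]_x (\sum_(k <oo) (step k x)%:E) < +oo)%E.
  rewrite integral_nneseries//=; last 2 first.
    by move=> k; apply/measurable_EFinP; exact: (bstep k).1.
    by move=> k x _; rewrite lee_fin normr_ge0.
  apply: (@le_lt_trans _ _ (2 * (fine (nu setT) + 1))%:E); last exact: ltry.
  apply: le_trans (epsilon_trick0 xpredT _); last first.
    by rewrite mulr_ge0// addr_ge0// fine_ge0.
  apply: lee_nneseries => [k _ _|k _].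
    by apply: integral_ge0 => x _; rewrite lee_fin normr_ge0.
  by rewrite -bint_EFin// lee_fin natrX; exact: int_step_le.
have mser : measurable_fun setT (fun x => \sum_(k <oo) (step k x)%:E)%E.
  apply: ge0_emeasurable_sum => k //=.
    by move=> x _ _; rewrite lee_fin normr_ge0.
  by move=> _; apply/measurable_EFinP; exact: (bstep k).1.
have : nu.-integrable setT (fun x => \sum_(k <oo) (step k x)%:E)%E.
  apply/integrableP; split => //.
  rewrite (eq_integral (fun x => \sum_(k <oo) (step k x)%:E)%E)// => x _.
  rewrite gee0_abs//; apply: nneseries_ge0 => k _ _.
  by rewrite lee_fin normr_ge0.
move/(integrable_ae measurableT); apply: filterS => x /(_ Logic.I) fin_ser.
have cn : cvgn [normed series (telescope (h ^~ x))].
  have nd : nondecreasing_seq (series (fun k => step k x)).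
    by apply: nondecreasing_series => n _ _; exact: normr_ge0.
  apply: nondecreasing_is_cvgn => //.
  exists (fine (\sum_(k <oo) (step k x)%:E)%E) => _ [n _ <-].
  rewrite -lee_fin fineK//.
  rewrite /series /= -sumEFin.
  by apply: nneseries_lim_ge => k _; rewrite lee_fin normr_ge0.
have := normed_cvg cn => /cvg_ex [l hl].
apply/cvg_ex; exists (h 0%N x + l).
rewrite (_ : h ^~ x = fun n => h 0%N x + series (telescope (h ^~ x)) n).
  by apply: cvgD => //; exact: cvg_cst.
apply/funext => n; exact: (eq_sum_telescope (h ^~ x) n).
Qed.

(** An everywhere defined representative of the limit: it depends on the values
    of the sequence at [x] only, hence inherits all their symmetries. *)
Definition limsup_fun (x : T) : R := fine (limn_esup (fun k => (h k x)%:E)).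

Lemma measurable_limsup_fun : measurable_fun setT limsup_fun.
Proof.
apply: measurableT_comp => //; apply: measurable_fun_limn_esup => k.
by apply/measurable_EFinP; exact: (bh k).1.
Qed.

Lemma limsup_fun_cvg x : cvgn (h ^~ x) -> (h ^~ x) n @[n --> \oo] --> limsup_fun x.
Proof.
move=> /cvg_ex[l hl].
have hlE : (fun k => (h k x)%:E) @ \oo --> l%:E by apply: cvg_EFin => //; exact: nearW.
by rewrite /limsup_fun (cvg_limn_einf_sup hlE).2.
Qed.

(** By Fatou, the distance to the pointwise limit is at most the distance to the
    far terms of the sequence. *)
Lemma limsup_fun_dist k :
  (\int[nu]_x ((limsup_fun x - h k x) ^+ 2)%:E <= ((2^-1 ^+ k) ^+ 2)%:E)%E.
Proof.
pose F j x := ((h (j + k)%N x - h k x) ^+ 2)%:E.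
have bF j : bmeas (fun x => (h (j + k)%N x - h k x) ^+ 2).
  by apply: bmeasM; exact: bmeasB.
have mF j : measurable_fun setT (F j) by apply/measurable_EFinP; exact: (bF j).1.
have F0 j x : setT x -> (0 <= F j x)%E by rewrite lee_fin sqr_ge0.
have mG : measurable_fun setT (fun x => ((limsup_fun x - h k x) ^+ 2)%:E).
  apply/measurable_EFinP; apply: measurable_funX.
  by apply: measurable_funB; [exact: measurable_limsup_fun|exact: (bh k).1].
have mI : measurable_fun setT (fun x => limn_einf (F ^~ x)).
  rewrite (_ : (fun x => _) = fun x => (- limn_esup (fun j => - F j x))%E) //.
  apply: measurableT_comp => //; apply: measurable_fun_limn_esup => j.
  exact: measurableT_comp.
have -> : (\int[nu]_x ((limsup_fun x - h k x) ^+ 2)%:E)%E =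
    (\int[nu]_x (limn_einf (F ^~ x)))%E.
  apply: ae_eq_integral => //.
  apply: filterS cauchy_ae_cvg => x cx _.
  suff /cvg_limn_einf_sup[-> _] : F ^~ x @ \oo --> ((limsup_fun x - h k x) ^+ 2)%:E by [].
  apply: cvg_EFin; first exact: nearW.
  have c1 : (h (j + k)%N x - h k x) @[j --> \oo] --> limsup_fun x - h k x.
    apply: cvgB; last exact: cvg_cst.
    by have := limsup_fun_cvg cx; rewrite -(cvg_shiftn k).
  rewrite (_ : fine \o F ^~ x = fun j =>
    (h (j + k)%N x - h k x) * (h (j + k)%N x - h k x)); first exact: cvgM.
  by apply/funext => j; rewrite /F /= expr2.
apply: le_trans (fatou nu measurableT mF F0) _.
apply: limn_einf_le_bound => j; rewrite /F -bint_EFin// lee_fin.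
by apply: hCauchy; rewrite leq_addl.
Qed.

End Completeness.

Lemma mean_square_integrable f c : measurable_fun setT f ->
  (\int[nu]_x ((f x) ^+ 2)%:E <= c%:E)%E ->
  nu.-integrable setT (fun x => ((f x) ^+ 2)%:E) /\
  \int[nu]_x (f x) ^+ 2 <= c.
Proof.
move=> mf fc.
have i2 : nu.-integrable setT (fun x => ((f x) ^+ 2)%:E).
  apply/integrableP; split.
    by apply/measurable_EFinP; exact: measurable_funX.
  under eq_integral do rewrite gee0_abs ?lee_fin ?sqr_ge0//.
  exact: le_lt_trans fc (ltry _).
split => //; rewrite -lee_fin fineK//.
exact: integrable_fin_num i2.
Qed.

(** The difference of products [f f' - g g'] is at most
    [((1 + 1/e) ((f - g)^2 + (f' - g')^2) + e (g^2 + g'^2)) / 2]. *)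
Lemma mean_square_product f f' g g' e M : 0 < e -> e <= 1 ->
  measurable_fun setT f -> measurable_fun setT f' -> bmeas g -> bmeas g' ->
  (\int[nu]_x ((f x - g x) ^+ 2)%:E <= (e ^+ 2)%:E)%E ->
  (\int[nu]_x ((f' x - g' x) ^+ 2)%:E <= (e ^+ 2)%:E)%E ->
  \int[nu]_x (g x) ^+ 2 <= M -> \int[nu]_x (g' x) ^+ 2 <= M ->
  nu.-integrable setT (fun x => (f x * f' x)%:E) /\
  `|\int[nu]_x (f x * f' x) - \int[nu]_x (g x * g' x)| <= e * (2 + M).
Proof.
move=> e0 e1 mf mf' bg bg' fg fg' gM gM'.
have mfg : measurable_fun setT (fun x => f x - g x).
  by apply: measurable_funB => //; exact: bg.1.
have mfg' : measurable_fun setT (fun x => f' x - g' x).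
  by apply: measurable_funB => //; exact: bg'.1.
have [i1 le1] := mean_square_integrable mfg fg.
have [i2 le2] := mean_square_integrable mfg' fg'.
have bg2 : bmeas (fun x => g x ^+ 2) by exact: bmeasM.
have bg2' : bmeas (fun x => g' x ^+ 2) by exact: bmeasM.
pose D x := (f x - g x) ^+ 2 + (f' x - g' x) ^+ 2.
pose G x := g x ^+ 2 + g' x ^+ 2.
have bG : bmeas G by exact: bmeasD.
have iD : nu.-integrable setT (EFin \o D) by exact: (integrableD measurableT i1 i2).
pose c := (1 + e^-1) / 2.
have iB : nu.-integrable setT (EFin \o (fun x => c * D x + e / 2 * G x)).
  apply: (integrableD measurableT (f := fun x => (c * D x)%:E)
    (g := fun x => (e / 2 * G x)%:E)).
    exact: (integrableZl measurableT c iD).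
  by apply: bmeas_integrable; exact: bmeasZ.
have dom x : `|f x * f' x - g x * g' x| <= c * D x + e / 2 * G x.
  set a := f x - g x; set a' := f' x - g' x.
  have -> : f x * f' x - g x * g' x = a * a' + a * g' x + g x * a'.
    by rewrite /a /a'; ring.
  have AG (y z t : R) : 0 < t -> `|y * z| <= (t^-1 * y ^+ 2 + t * z ^+ 2) / 2.
    move=> t0; rewrite normrM -(real_normK (num_real y)) -(real_normK (num_real z)).
    have : 0 <= t^-1 * (`|y| - t * `|z|) ^+ 2.
      by rewrite mulr_ge0 ?sqr_ge0// invr_ge0 ltW.
    have -> : t^-1 * (`|y| - t * `|z|) ^+ 2 =
      t^-1 * `|y| ^+ 2 + t * `|z| ^+ 2 - 2 * (`|y| * `|z|).
      by field; rewrite gt_eqF.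
    by lra.
  have H1 := AG a a' 1 ltr01; have H2 := AG a (g' x) e e0.
  have H3 := AG a' (g x) e e0.
  have N1 := ler_normD (a * a' + a * g' x) (g x * a').
  have N2 := ler_normD (a * a') (a * g' x).
  have -> : c * D x + e / 2 * G x =
    (1^-1 * a ^+ 2 + 1 * a' ^+ 2) / 2 + (e^-1 * a ^+ 2 + e * g' x ^+ 2) / 2 +
    (e^-1 * a' ^+ 2 + e * g x ^+ 2) / 2.
    by rewrite /c /D /G -/a -/a' invr1; field; rewrite gt_eqF.
  by rewrite (mulrC a' (g x)) in H3; lra.
have bgg : bmeas (fun x => g x * g' x) by exact: bmeasM.
have mdiff : measurable_fun setT (fun x => f x * f' x - g x * g' x).
  by apply: measurable_funB; [exact: measurable_funM|exact: bgg.1].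
have idiff : nu.-integrable setT (EFin \o (fun x => f x * f' x - g x * g' x)).
  apply: le_integrable iB => //; first exact/measurable_EFinP.
  move=> x _ /=; rewrite lee_fin; apply: le_trans (dom x) _; exact: ler_norm.
have iff' : nu.-integrable setT (fun x => (f x * f' x)%:E).
  have := integrableD measurableT idiff (bmeas_integrable nu bgg).
  by apply: eq_integrable => // x _ /=; rewrite -EFinD subrK.
split => //.
rewrite -RintegralB//; last exact: bmeas_integrable.
apply: le_trans (le_normr_Rintegral measurableT idiff) _.
apply: (@le_trans _ _ (\int[nu]_x (c * D x + e / 2 * G x))).
  by apply: le_Rintegral => //; exact: (integrable_norm idiff).
rewrite RintegralD//; last 2 first.
  exact: (integrableZl measurableT c iD).
  by apply: bmeas_integrable; exact: bmeasZ.
have -> : \int[nu]_x (c * D x) = c * \int[nu]_x D x by exact: RintegralZl.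
have -> : \int[nu]_x D x = \int[nu]_x (f x - g x) ^+ 2 +
  \int[nu]_x (f' x - g' x) ^+ 2 by exact: RintegralD.
rewrite bintZ// bintD//.
have c0 : 0 <= c by rewrite /c divr_ge0// addr_ge0// invr_ge0 ltW.
apply: (@le_trans _ _ (c * (e ^+ 2 + e ^+ 2) + e / 2 * (M + M))).
  apply: lerD; first by rewrite ler_wpM2l// lerD.
  by rewrite ler_wpM2l ?lerD// divr_ge0// ltW.
have -> : c * (e ^+ 2 + e ^+ 2) + e / 2 * (M + M) = e * (e + 1 + M).
  by rewrite /c; field; rewrite gt_eqF.
by rewrite ler_wpM2l ?(ltW e0)//; lra.
Qed.

End MeanSquare.

(** * The square root of a positive definite kernel *)

Lemma half_pow_small (R : archiRealFieldType) (A b : R) : 0 <= A -> 0 < b ->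
  exists k, forall j, (k <= j)%N -> 2^-1 ^+ j * A < b.
Proof.
move=> A0 b0; exists (Num.bound (A / b)) => j kj.
have H : A / b < j%:R.
  by apply: lt_le_trans (archi_boundP _) _; rewrite ?divr_ge0 ?(ltW b0)// ler_nat.
rewrite exprVn mulrC ltr_pdivrMr ?exprn_gt0// mulrC -ltr_pdivrMr//.
by apply: lt_trans H _; rewrite -natrX ltr_nat ltn_expl.
Qed.

Section KernelRootLimit.
Context {R : realType} {d} {T : measurableType d}.
Variables (nu : {finite_measure set T -> \bar R}) (X : T -> T -> R).
Hypotheses (bX : bker X) (Xsym : ksym X) (Xpsd : psd X).
Hypothesis nu_gt0 : 0 < fine (nu setT).
Hypothesis Xcontr : forall u, \int[nu]_w `|X u w| <= 1.

(** A kernel polynomial is a multiple of [X] plus a convolution with [X] on the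
    right, and [X] transmits its modulus of continuity in the second variable. *)
Lemma kpoly_modulus (r : {poly R}) : exists2 C, 0 < C &
  forall u v w e, (forall z, `|X z w - X z v| <= e) ->
    `|kpoly nu X r u w - kpoly nu X r u v| <= C * e.
Proof.
elim/poly_ind: r => [|p c _].
  exists 1 => // u v w e /(_ u) Xe.
  by rewrite !kpoly0 subrr normr0 mul1r (le_trans _ Xe).
have [_ [B pB]] := bker_kpoly nu bX p.
exists (`|B| * fine (nu setT) + `|c| + 1) => [|u v w e Xe].
  by rewrite ltr_wpDl// addr_ge0// mulr_ge0// ltW.
have e0 : 0 <= e by apply: le_trans (Xe u).
have Epoly z : kpoly nu X (p * 'X + c%:P) u z =
    \int[nu]_y (kpoly nu X p u y * X y z) + c * X u z.
  rewrite kpolyD kpolyC; congr (_ + _).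
  transitivity (conv nu (kpoly nu X p) (kpoly nu X 1) u z).
    by rewrite kpolyM// mulr1 mulrC.
  by apply: eq_Rintegral => y _; rewrite kpoly1.
have bp z : bmeas (fun y => kpoly nu X p u y * X y z).
  by apply: bker_mul => //; exact: bker_kpoly.
rewrite !Epoly opprD addrACA -bintB// -mulrBr.
apply: le_trans (ler_normD _ _) _.
rewrite !mulrDl mul1r ler_wpDr// lerD//; last by rewrite normrM ler_wpM2l.
rewrite mulrAC; apply: bint_norm_bound; last exact: bmeasB.
move=> y; rewrite -mulrBr normrM ler_pM//.
by apply: le_trans (pB (u, y)) _; exact: ler_norm.
Qed.

Variables (S : set T) (t : nat -> R) (e0 : T).
Hypothesis Se0 : S e0.
Hypothesis energy_cst : forall n u, S u -> kroot_energy nu X n u = t n.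
Hypothesis caps : forall v e, S v -> 0 < e -> exists C : set T,
  [/\ measurable C, (0 < nu C)%E, C `<=` S &
      forall w z, C w -> `|X z w - X z v| <= e].

Lemma kroot_energy_cauchy e : 0 < e ->
  exists N, forall m n, (N <= m)%N -> (m <= n)%N -> t n - t m <= e.
Proof.
move=> e_gt0.
have tnd : nondecreasing_seq t.
  move=> m n mn; rewrite -subr_ge0 -!(energy_cst _ Se0).
  apply: le_trans (kroot_diff_le bX Xsym Xpsd nu_gt0 Xcontr e0 mn).
  by apply: Rintegral_ge0 => w _; exact: sqr_ge0.
have tub : has_ubound (range t).
  exists (X e0 e0) => _ [n _ <-]; rewrite -(energy_cst _ Se0).
  exact: kroot_energy_le.
have sup_t : has_sup (range t) by split => //; exists (t 0%N), 0%N.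
have [_ [N _ <-] tN] := sup_adherent e_gt0 sup_t.
exists N => m n Nm mn.
have : t n <= sup (range t) by apply: ub_le_sup => //; exists n.
have := tnd _ _ Nm; lra.
Qed.

(** Along a fast subsequence the iterates converge in mean square, uniformly over
    the points of [S], so their convolution squares converge uniformly on [S].
    The limit is [X]: the residuals tend to zero in mean square, whereas a
    nonzero limit of the residuals at a point [v] would persist, by
    [kpoly_modulus], on a whole set of positive measure around [v]. *)
Lemma kernel_root_exists : exists N : nat -> nat,
  let g u v := limsup_fun (fun k => kroot nu X (N k) u) v in
  forall u v, S u -> S v ->
    nu.-integrable setT (fun w => (g u w * g w v)%:E) /\
    X u v = \int[nu]_w (g u w * g w v).
Proof.
have [f fP] : {f : nat -> nat & forall k m n, (f k <= m)%N -> (m <= n)%N ->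
    t n - t m <= (2^-1 ^+ k) ^+ 2}.
  have H k : {N : nat | forall m n, (N <= m)%N -> (m <= n)%N ->
      t n - t m <= (2^-1 ^+ k) ^+ 2}.
    by apply/cid/kroot_energy_cauchy; rewrite !exprn_gt0.
  by exists (fun k => sval (H k)) => k; exact: svalP (H k).
(* A sum rather than [f] itself, to make the indices nondecreasing. *)
pose N k := (\sum_(i < k.+1) f i)%N.
have fN k : (f k <= N k)%N by rewrite /N big_ord_recr leq_addl.
have Nnd k j : (k <= j)%N -> (N k <= N j)%N.
  move=> /subnKC <-; elim: (j - k)%N => [|i ih]; first by rewrite addn0.
  by rewrite addnS (leq_trans ih)// /N [leqRHS]big_ord_recr leq_addr.
exists N => g.
pose h u k := kroot nu X (N k) u.
have bh u k : bmeas (h u k) by exact/bker_row/bker_kroot.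
have hC u : S u -> forall k j, (k <= j)%N ->
    \int[nu]_x (h u j x - h u k x) ^+ 2 <= (2^-1 ^+ k) ^+ 2.
  move=> Su k j kj.
  apply: le_trans (kroot_diff_le bX Xsym Xpsd nu_gt0 Xcontr u (Nnd _ _ kj)) _.
  by rewrite !energy_cst//; apply: fP => //; exact: Nnd.
have gsym u v : g u v = g v u.
  by rewrite /g /limsup_fun; under eq_fun do rewrite kroot_sym//.
have [_ [M XM]] := bX.
have M0 : 0 <= M by apply: le_trans (XM (e0, e0)).
have energy_le u k : \int[nu]_x (h u k x) ^+ 2 <= M.
  rewrite -kroot_energyE//; apply: le_trans (kroot_energy_le _ _ _ _ _ _ _) _ => //.
  by apply: le_trans (ler_norm _) (XM (u, u)).
have approx u v k : S u -> S v ->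
    nu.-integrable setT (fun w => (g u w * g w v)%:E) /\
    `|\int[nu]_w (g u w * g w v) - conv nu (kroot nu X (N k)) (kroot nu X (N k)) u v|
      <= 2^-1 ^+ k * (2 + M).
  move=> Su Sv.
  have k_gt0 : 0 < (2^-1 : R) ^+ k by rewrite exprn_gt0.
  have k_le1 : (2^-1 : R) ^+ k <= 1 by rewrite exprn_ile1// invf_le1// ler1n.
  have := mean_square_product k_gt0 k_le1
    (measurable_limsup_fun (bh u)) (measurable_limsup_fun (bh v))
    (bh u k) (bh v k) (limsup_fun_dist (bh u) (hC u Su) k)
    (limsup_fun_dist (bh v) (hC v Sv) k) (energy_le u k) (energy_le v k).
  rewrite (_ : (fun x => (_ * _)%:E) = (fun w => (g u w * g w v)%:E)); last first.
    by apply/funext => w; rewrite [g w v]gsym.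
  rewrite (_ : \int[nu]_x (limsup_fun _ x * _) = \int[nu]_w (g u w * g w v)); last first.
    by apply: eq_Rintegral => w _; rewrite [g w v]gsym.
  rewrite (_ : \int[nu]_x (h u k x * h v k x) =
    conv nu (kroot nu X (N k)) (kroot nu X (N k)) u v)//.
  by apply: eq_Rintegral => w _; rewrite [kroot _ _ _ w v]kroot_sym.
move=> u v Su Sv; split; first exact: (approx u v 0%N Su Sv).1.
(* [Dk k] is the residual of the [k]-th chosen iterate and [D] their limit. *)
pose D u v := X u v - \int[nu]_w (g u w * g w v).
pose Dk k u v := X u v - conv nu (kroot nu X (N k)) (kroot nu X (N k)) u v.
have DkE k u' v' : Dk k u' v' =
    2 * (kroot nu X (N k).+1 u' v' - kroot nu X (N k) u' v').
  by rewrite /Dk kroot_residual.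
have DDk k w : S w -> `|D u w - Dk k u w| <= 2^-1 ^+ k * (2 + M).
  move=> Sw; have [_ ] := approx u w k Su Sw; rewrite distrC; congr (`|_| <= _).
  by rewrite /D /Dk; ring.
suff : D u v = 0 by move/subr0_eq.
apply: contrapT => /eqP D0.
have a0 : 0 < `|D u v| by rewrite normr_gt0.
set a := `|D u v| in a0.
have [k0 k0P] : exists k, forall j, (k <= j)%N -> 2^-1 ^+ j * (2 + M) < a / 8.
  by apply: half_pow_small; [rewrite addr_ge0|rewrite divr_gt0].
have [Cm Cm0 mod0] := kpoly_modulus (sqrt_iter (N k0).+1 - sqrt_iter (N k0)).
have [|C [mC nuC CS Ccap]] := @caps v (a / 16 / Cm) Sv.
  by rewrite !divr_gt0.
have Dcap k w : (k0 <= k)%N -> C w -> a / 2 <= `|Dk k u w|.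
  move=> k0k Cw.
  have H1 := DDk k w (CS _ Cw); have H2 := DDk k0 w (CS _ Cw).
  have H3 := DDk k0 v Sv.
  have H4 : `|Dk k0 u w - Dk k0 u v| <= a / 8.
    rewrite !DkE -mulrBr normrM ger0_norm// /kroot -!kpolyB.
    have := mod0 u v w _ (fun z => Ccap w z Cw).
    rewrite mulrC divfK ?gt_eqF//; lra.
  have K1 := k0P k k0k; have K2 := k0P k0 (leqnn _).
  have tri (x y z : R) : `|x - y| <= z -> `|x| <= z + `|y| /\ `|y| <= z + `|x|.
    move=> xyz; have := ler_normD (x - y) y; have := ler_normD (y - x) x.
    by rewrite !subrK distrC; split; lra.
  have [N1 _] := tri _ _ _ H3; have [_ N2] := tri _ _ _ H4.
  have [_ N3] := tri _ _ _ H2; have [N4 _] := tri _ _ _ H1.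
  rewrite -/a in N1; lra.
have bD k : bmeas (fun w => (Dk k u w) ^+ 2).
  suff : bmeas (Dk k u) by move=> b; exact: bmeasM.
  rewrite (_ : Dk k u = fun w =>
    2 * (kroot nu X (N k).+1 u w - kroot nu X (N k) u w)); last first.
    by apply/funext => w; exact: DkE.
  by apply/bmeasZ/bmeasB; exact/bker_row/bker_kroot.
have intD k : \int[nu]_w (Dk k u w) ^+ 2 <= 4 * (2^-1 ^+ k) ^+ 2.
  have b1 : bmeas (fun w => (kroot nu X (N k).+1 u w - kroot nu X (N k) u w) ^+ 2).
    have b2 : bmeas (fun w => kroot nu X (N k).+1 u w - kroot nu X (N k) u w).
      by apply: bmeasB; exact/bker_row/bker_kroot.
    exact: bmeasM.
  rewrite (_ : \int[nu]_w _ = 4 *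
      \int[nu]_w (kroot nu X (N k).+1 u w - kroot nu X (N k) u w) ^+ 2); last first.
    by rewrite -bintZ//; apply: eq_Rintegral => w _; rewrite DkE; ring.
  rewrite ler_pM2l//.
  apply: le_trans (kroot_diff_le bX Xsym Xpsd nu_gt0 Xcontr u (leqnSn _)) _.
  by rewrite !energy_cst//; exact: fP.
have lowD k : (k0 <= k)%N -> (a / 2) ^+ 2 * fine (nu C) <= \int[nu]_w (Dk k u w) ^+ 2.
  move=> k0k.
  have bC : bmeas (fun w => (a / 2) ^+ 2 * \1_C w : R).
    apply: bmeasZ; split; first exact: measurable_indic.
    by exists 1 => w; rewrite indicE; case: (w \in C); rewrite /= ?normr1 ?normr0.
  apply: (@le_trans _ _ (\int[nu]_w ((a / 2) ^+ 2 * \1_C w))).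
    rewrite bintZ; last first.
      split; first exact: measurable_indic.
      by exists 1 => w; rewrite indicE; case: (w \in C); rewrite /= ?normr1 ?normr0.
    by rewrite /Rintegral integral_indic// setIT.
  apply: le_bint => // w; rewrite indicE; case: (boolP (w \in C)) => wC /=.
    rewrite mulr1 -(real_normK (num_real (Dk k u w))) ler_sqr ?nnegrE//.
      by apply: Dcap => //; exact: set_mem.
    by rewrite divr_ge0// ltW.
  by rewrite mulr0 sqr_ge0.
have fC0 : 0 < fine (nu C).
  by rewrite fine_gt0// nuC /= -ge0_fin_numE// fin_num_measure.
have [k1 k1P] : exists k, forall j, (k <= j)%N ->
    2^-1 ^+ j * 4 < (a / 2) ^+ 2 * fine (nu C).
  by apply: half_pow_small => //; rewrite mulr_gt0// exprn_gt0// divr_gt0.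
have := k1P (maxn k0 k1) (leq_maxr _ _); have := lowD (maxn k0 k1) (leq_maxl _ _).
have := intD (maxn k0 k1).
set p : R := 2^-1 ^+ _.
have p0 : 0 <= p by rewrite exprn_ge0.
have p1 : p <= 1 by rewrite exprn_ile1// invf_le1// ler1n.
have : p ^+ 2 <= p by rewrite expr2 ler_piMr.
lra.
Qed.

End KernelRootLimit.

(** * The Hausdorff outer measure *)

Section EuclideanNorm.
Context {R : realType} {n : nat}.
Implicit Types (u v x y : 'rV[R]_n) (A B : set 'rV[R]_n).

Lemma dotpC u v : dotp u v = dotp v u.
Proof. by apply: eq_bigr => i _; rewrite mulrC. Qed.

Lemma dotpDl u v x : dotp (u + v) x = dotp u x + dotp v x.
Proof. by rewrite -big_split; apply: eq_bigr => i _; rewrite mxE mulrDl. Qed.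

Lemma dotpZl c u x : dotp (c *: u) x = c * dotp u x.
Proof. by rewrite mulr_sumr; apply: eq_bigr => i _; rewrite mxE mulrA. Qed.

Lemma dotpBl u v x : dotp (u - v) x = dotp u x - dotp v x.
Proof. by rewrite -scaleN1r dotpDl dotpZl mulN1r. Qed.

Lemma dotpDr u v x : dotp x (u + v) = dotp x u + dotp x v.
Proof. by rewrite !(dotpC x) dotpDl. Qed.

Lemma dotpZr c u x : dotp x (c *: u) = c * dotp x u.
Proof. by rewrite !(dotpC x) dotpZl. Qed.

Lemma dotpBr u v x : dotp x (u - v) = dotp x u - dotp x v.
Proof. by rewrite !(dotpC x) dotpBl. Qed.

Lemma dotp_ge0 u : 0 <= dotp u u.
Proof. by apply: sumr_ge0 => i _; rewrite -expr2 sqr_ge0. Qed.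

Lemma enorm_sqr u : enorm u ^+ 2 = dotp u u.
Proof. by rewrite sqr_sqrtr// dotp_ge0. Qed.

Lemma enorm_ge0 u : 0 <= enorm u.
Proof. exact: sqrtr_ge0. Qed.

Lemma coord_le_enorm u i : `|u 0 i| <= enorm u.
Proof.
rewrite -sqrtr_sqr ler_wsqrtr// /dotp (bigD1 i)//= -expr2 lerDl.
by apply: sumr_ge0 => j _; rewrite -expr2 sqr_ge0.
Qed.

Lemma ediam_ge A u v : A u -> A v -> ((enorm (u - v))%:E <= ediam A)%E.
Proof.
by move=> Au Av; apply: ereal_sup_ubound; right; exists (u, v).
Qed.

Lemma ediam_ge0 A : (0 <= ediam A)%E.
Proof. by apply: ereal_sup_ubound; left. Qed.

Lemma ediam_le A (e : R) : 0 <= e ->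
  (forall u v, A u -> A v -> enorm (u - v) <= e) -> (ediam A <= e%:E)%E.
Proof.
move=> e0 Ae; apply: ge_ereal_sup => _ [->|[[u v] [/= Au Av] <-]].
  by rewrite lee_fin.
by rewrite lee_fin; exact: Ae.
Qed.

Lemma ediam0 : ediam (@set0 'rV[R]_n) = 0%E.
Proof.
by apply/eqP; rewrite eq_le ediam_ge0 andbT; apply: ediam_le.
Qed.

End EuclideanNorm.

Section HausdorffOuterMeasure.
Context {R : realType} {n : nat}.
Variable s : nat.
Local Notation E := 'rV[R]_n.
Implicit Types (A B : set E) (F : (set E)^nat) (delta : R).

Lemma ball_volume_gt0 k : 0 < ball_volume k :> R.
Proof.
suff : 0 < ball_volume k :> R /\ 0 < ball_volume k.+1 :> R by case.
elim: k => [|k [ih1 ih2]] //; split => //.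
by rewrite /= mulr_gt0// divr_gt0// mulr_gt0// pi_gt0.
Qed.

Definition gauge A : \bar R :=
  ((ball_volume s.+1 / 2 ^+ s.+1)%:E * ediam A ^+ s.+1)%E.

Lemma gauge_ge0 A : (0 <= gauge A)%E.
Proof.
apply: mule_ge0; last exact/expe_ge0/ediam_ge0.
by rewrite lee_fin divr_ge0// ?exprn_ge0// ltW// ball_volume_gt0.
Qed.

Lemma gauge0 : gauge set0 = 0%E.
Proof. by rewrite /gauge ediam0 expeS mul0e mule0. Qed.

(** Allowing all covers but giving infinite weight to the sets of large diameter
    presents the premeasure as the outer measure induced by a set function. *)
Local Notation D := (g_sigma_algebraType [set: set E]).

Let gauge_upto delta A : \bar R :=
  if (ediam A <= delta%:E)%E then gauge A else +oo%E.

Let gauge_upto_ge0 delta A : (0 <= gauge_upto delta A)%E.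
Proof. by rewrite /gauge_upto; case: ifP => // _; exact: gauge_ge0. Qed.

Let gauge_upto0 delta : 0 < delta -> gauge_upto delta set0 = 0%E.
Proof.
by move=> d0; rewrite /gauge_upto ediam0 lee_fin ltW// gauge0.
Qed.

Let hausdorff_pre_mu_ext delta A : hausdorff_pre s.+1 delta A =
  @mu_ext _ D R (gauge_upto delta) A.
Proof.
apply/eqP; rewrite eq_le; apply/andP; split.
- apply: le_ereal_inf_tmp => _ [F [_ AF] <-].
  have [Fd|] := pselect (forall k, (ediam (F k) <= delta%:E)%E).
    apply: ereal_inf_lbound; exists F => //.
    apply: eq_eseriesr => k _; rewrite /gauge_upto.
    by rewrite Fd.
  move=> /existsNP[k Fk].
  rewrite (@eseries_pinfty _ _ _ k) ?leey//.
    by move=> j _; rewrite -ltNye (lt_le_trans ltNy0)// gauge_upto_ge0.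
  by rewrite /gauge_upto; case: ifP.
- apply: le_ereal_inf_tmp => _ [F [AF Fd] <-].
  apply: ereal_inf_lbound; exists F.
    by split => // i; exact: sub_sigma_algebra.
  apply: eq_eseriesr => k _; rewrite /gauge_upto.
  by rewrite Fd.
Qed.

Lemma hausdorff_pre_subadditive delta : 0 < delta ->
  sigma_subadditive (hausdorff_pre s.+1 delta : set E -> \bar R).
Proof.
move=> d0 F; rewrite hausdorff_pre_mu_ext.
apply: le_trans (@mu_ext_sigma_subadditive _ D R _ (gauge_upto_ge0 delta) F) _.
apply: lee_nneseries => [k _ _|k _]; last by rewrite hausdorff_pre_mu_ext.
exact: (@mu_ext_ge0 _ D R _ (gauge_upto_ge0 delta)).
Qed.

Lemma hausdorff_pre_ge0 delta A : (0 <= hausdorff_pre s.+1 delta A)%E.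
Proof.
by rewrite hausdorff_pre_mu_ext; exact: (@mu_ext_ge0 _ D R _ (gauge_upto_ge0 delta)).
Qed.

Lemma le_hausdorff_pre delta A B : A `<=` B ->
  (hausdorff_pre s.+1 delta A <= hausdorff_pre s.+1 delta B)%E.
Proof. by move=> AB; rewrite !hausdorff_pre_mu_ext le_mu_ext. Qed.

Lemma hausdorff_pre_antitone delta delta' A : delta <= delta' ->
  (hausdorff_pre s.+1 delta' A <= hausdorff_pre s.+1 delta A)%E.
Proof.
move=> dd'; apply: ereal_inf_le_tmp => _ [F [AF Fd] <-]; exists F => //.
by split => // k; apply: le_trans (Fd k) _; rewrite lee_fin.
Qed.

Lemma hausdorff_pre_le delta A : 0 < delta ->
  (hausdorff_pre s.+1 delta A <= hausdorff s.+1 A)%E.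
Proof. by move=> d0; apply: ereal_sup_ubound; exists delta. Qed.

Let hausdorff0 : hausdorff s.+1 (@set0 E) = 0%E.
Proof.
apply/eqP; rewrite eq_le; apply/andP; split.
  apply: ge_ereal_sup => _ [delta d0 <-].
  rewrite hausdorff_pre_mu_ext.
  by rewrite (@mu_ext0 _ D R _ (gauge_upto0 d0) (gauge_upto_ge0 delta)).
by apply: le_trans (hausdorff_pre_le _ ltr01); exact: hausdorff_pre_ge0.
Qed.

Let hausdorff_ge0 A : (0 <= hausdorff s.+1 A)%E.
Proof. by apply: le_trans (hausdorff_pre_le _ ltr01); exact: hausdorff_pre_ge0. Qed.

Let le_hausdorff : {homo (hausdorff s.+1 : set E -> \bar R) : A B / A `<=` B >-> (A <= B)%E}.
Proof.
move=> A B AB; apply: ge_ereal_sup => _ [delta d0 <-].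
by apply: le_trans (hausdorff_pre_le _ d0); exact: le_hausdorff_pre.
Qed.

Let hausdorff_subadditive : sigma_subadditive (hausdorff s.+1 : set E -> \bar R).
Proof.
move=> F; apply: ge_ereal_sup => _ [delta d0 <-].
apply: le_trans (hausdorff_pre_subadditive d0 F) _.
apply: lee_nneseries => [k _ _|k _]; first exact: hausdorff_pre_ge0.
exact: hausdorff_pre_le.
Qed.

HB.instance Definition _ := isOuterMeasure.Build R E (hausdorff s.+1)
  hausdorff0 hausdorff_ge0 le_hausdorff hausdorff_subadditive.

(** A piece of diameter less than the distance from [A] to [B] meets at most one
    of them, so a fine cover of the union splits into covers of [A] and [B]. *)
Lemma hausdorff_separated A B (e : R) : 0 < e ->
  (forall a b, A a -> B b -> e <= enorm (a - b)) ->
  (hausdorff s.+1 A + hausdorff s.+1 B <= hausdorff s.+1 (A `|` B))%E.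
Proof.
move=> e0 AB; set c := hausdorff s.+1 (A `|` B).
have key delta : 0 < delta -> delta < e ->
    (hausdorff_pre s.+1 delta A + hausdorff_pre s.+1 delta B <=
     hausdorff_pre s.+1 delta (A `|` B))%E.
  move=> d0 de; apply: le_ereal_inf_tmp => _ [F [ABF Fd] <-].
  pose G C k := if `[< F k `&` C !=set0 >] then F k else set0.
  have GF C k : (ediam (G C k) <= delta%:E)%E.
    by rewrite /G; case: ifP => // _; rewrite ediam0 lee_fin ltW.
  have Gcov C : C `<=` A `|` B -> delta_cover delta C (G C).
    move=> CAB; split => // x Cx; have [k _ Fkx] := ABF _ (CAB _ Cx).
    by exists k => //; rewrite /G asboolT//; exists x.
  apply: (@le_trans _ _ (\sum_(k <oo) gauge (G A k) + \sum_(k <oo) gauge (G B k))%E).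
    apply: leeD; apply: ereal_inf_lbound.
      by exists (G A) => //; apply: Gcov => x; left.
    by exists (G B) => //; apply: Gcov => x; right.
  rewrite -nneseriesD; [|by move=> k _ _; exact: gauge_ge0..].
  apply: lee_nneseries => [k _ _|k _]; first by rewrite adde_ge0// gauge_ge0.
  rewrite /G; case: asboolP => [[a [Fa Aa]]|_]; case: asboolP => [[b [Fb Bb]]|_].
  - have := le_trans (ediam_ge Fa Fb) (Fd k); rewrite lee_fin => H.
    by have := lt_le_trans de (AB _ _ Aa Bb); rewrite ltNge H.
  - by rewrite gauge0 adde0.
  - by rewrite gauge0 add0e.
  - by rewrite gauge0 add0e gauge_ge0.
have key2 delta delta' : 0 < delta -> 0 < delta' ->
    (hausdorff_pre s.+1 delta A + hausdorff_pre s.+1 delta' B <= c)%E.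
  move=> d0 d'0; pose m := Num.min (Num.min delta delta') (e / 2).
  have m0 : 0 < m by rewrite !lt_min d0 d'0 divr_gt0.
  have me : m < e by rewrite !gt_min ltr_pdivrMr// ltr_pMr// ltr1n !orbT.
  apply: le_trans (hausdorff_pre_le _ m0); apply: le_trans (key _ m0 me).
  by apply: leeD; apply: hausdorff_pre_antitone; rewrite /m !ge_min lexx ?orbT.
have [->|cfin] := eqVneq c +oo%E; first exact: leey.
have cf : c \is a fin_num by rewrite ge0_fin_numE ?ltey//; exact: hausdorff_ge0.
have Bfin delta : 0 < delta -> hausdorff_pre s.+1 delta B \is a fin_num.
  move=> d0; rewrite ge0_fin_numE ?hausdorff_pre_ge0//.
  apply: le_lt_trans (_ : c < +oo)%E; last by rewrite ltey.
  by apply: le_trans (key2 1 delta ltr01 d0); rewrite leeDr// hausdorff_pre_ge0.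
have supA delta : 0 < delta -> (hausdorff s.+1 A <= c - hausdorff_pre s.+1 delta B)%E.
  move=> d0; apply: ge_ereal_sup => _ [delta' d'0 <-].
  by rewrite leeBrDr ?Bfin// key2.
have Afin : hausdorff s.+1 A \is a fin_num.
  rewrite ge0_fin_numE; last exact: hausdorff_ge0.
  apply: le_lt_trans (supA 1 ltr01) _.
  by rewrite ltey_eq fin_numB cf Bfin.
rewrite addeC -leeBrDr//; apply: ge_ereal_sup => _ [delta d0 <-].
by rewrite leeBrDr// addeC -leeBrDr ?Bfin// supA.
Qed.

End HausdorffOuterMeasure.

(** * The Hausdorff measure on Borel sets *)

Section MetricOuterMeasure.
Context {R : realType} {n : nat}.
Local Notation E := 'rV[R]_n.
Variable mu : {outer_measure set E -> \bar R}.
Hypothesis separated : forall (A B : set E) (e : R), 0 < e ->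
  (forall a b, A a -> B b -> e <= enorm (a - b)) ->
  (mu A + mu B <= mu (A `|` B))%E.

(** The layers [1/(j+2) < f <= 1/(j+1)] of a set of finite measure have summable
    measures, since the layer [j] is separated from the part [f <= 1/(j+3)];
    hence little measure is lost by removing a thin neighbourhood of
    [f <= 0]. *)
Lemma lipschitz_caratheodory (f : E -> R) :
  (forall x y, f x - f y <= enorm (x - y)) ->
  mu.-caratheodory [set x | 0 < f x].
Proof.
move=> f_lip; apply: le_caratheodory_measurable => X.
have [->|Xfin] := eqVneq (mu X) +oo%E; first exact: leey.
pose c (j : nat) : R := j.+1%:R^-1.
have cS j : c j.+1 < c j by rewrite /c ltf_pV2 ?posrE// ltr_nat.
pose phi j := mu (X `&` [set x | f x <= c j]).
pose ring j := X `&` [set x | c j.+1 < f x /\ f x <= c j].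
(* Telescoping [ring_le] bounds the sum of the measures of the layers. *)
have ring_le j : (mu (ring j) + phi j.+2 <= phi j)%E.
  apply: le_trans (separated (e := c j.+1 - c j.+2) _ _) _.
  - by rewrite subr_gt0.
  - move=> a b [_ [ca _]] [_ cb]; apply: le_trans (f_lip a b).
    by apply: lerB => //; exact: ltW.
  - apply: le_outer_measure => x [[Xx [_ fx]]|[Xx fx]]; split => //=.
    by apply: le_trans fx _; apply/ltW/(lt_trans (cS _)).
have sum_le k : (\sum_(j < k) mu (ring j) + (phi k + phi k.+1) <= phi 0%N + phi 1%N)%E.
  elim: k => [|k ih]; first by rewrite big_ord0 add0e.
  apply: le_trans ih; rewrite big_ord_recr /= -addeA leeD2l//.
  by rewrite addeCA (addeC (phi k)) leeD2l.
have ring_fin : (\sum_(j <oo) mu (ring j) < +oo)%E.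
  apply: (@le_lt_trans _ _ (phi 0%N + phi 1%N)%E).
    apply: lime_le.
      by apply: is_cvg_nneseries => j _ _; exact: outer_measure_ge0.
    apply: nearW => k; rewrite big_mkord; apply: le_trans (sum_le k).
    by rewrite leeDl// adde_ge0// outer_measure_ge0.
  have phi_fin j : (phi j < +oo)%E.
    apply: le_lt_trans (_ : mu X < +oo)%E; last by rewrite ltey.
    by apply: le_outer_measure; exact: subIsetl.
  by rewrite lte_add_pinfty.
apply/lee_addgt0Pr => e e0.
have tail := nneseries_tail_cvg ring_fin (fun j _ => outer_measure_ge0 mu (ring j)).
have e0' : (0 < e%:E)%E by rewrite lte_fin.
have [N _ /(_ N (leqnn N)) /= tailN] := tail _ (open_ereal_lt' e0').
pose above r := [set x | r < f x].
change [set x | 0 < f x] with (above 0).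
have far : (mu (X `&` above (c N)) + mu (X `&` ~` above 0%R) <= mu X)%E.
  apply: le_trans (separated (e := c N) _ _) _.
  - by rewrite invr_gt0.
  - move=> a b [_ ca] [_ /= /negP]; rewrite -leNgt => fb.
    have {}ca : c N < f a := ca.
    by apply: le_trans (f_lip a b); lra.
  - by apply: le_outer_measure => x [[]|[]].
have near0 : (mu (X `&` above 0%R) <=
    mu (X `&` above (c N)) + e%:E)%E.
  have sub : X `&` above 0%R `<=`
      (X `&` above (c N)) `|` \bigcup_(j in ~` `I_N) ring j.
    move=> x [Xx fx]; have [fc|fc] := ltP (c N) (f x); first by left.
    right.
    have ex : exists j, c j < f x.
      exists (Num.bound (f x)^-1); rewrite /c -[ltRHS]invrK ltf_pV2 ?posrE ?invr_gt0//.
      apply: lt_trans (archi_boundP _) _; first by rewrite invr_ge0 ltW.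
      by rewrite ltr_nat.
    case: (ex_minnP ex) => -[|m] cm mmin.
      have : c N <= c 0%N by rewrite /c lef_pV2 ?posrE// ler_nat.
      by move: fc cm => /=; lra.
    have Nm : (N <= m)%N.
      rewrite leqNgt; apply/negP => mN.
      have : c N <= c m.+1 by rewrite /c lef_pV2 ?posrE// ler_nat.
      by move: fc cm => /=; lra.
    exists m; first by apply/negP; rewrite -leqNgt.
    split => //; split => //; rewrite leNgt; apply/negP => cmf.
    by have := mmin m cmf; rewrite ltnn.
  apply: le_trans (le_outer_measure mu _ _ sub) _.
  apply: le_trans (outer_measureU2 _ _ _) _; rewrite leeD2l//.
  by apply: le_trans (outer_measure_sigma_subadditive_tail _ _ _) _; exact: ltW.
apply: le_trans (leeD2r _ near0) _; rewrite addeAC; exact: leeD2r.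
Qed.

Lemma mx_norm_le_enorm (x : E) : `|x| <= enorm x.
Proof.
rewrite [leLHS]mx_normrE; apply: bigmax_le; first exact: enorm_ge0.
by move=> [i j] _ /=; rewrite (ord1 i); exact: coord_le_enorm.
Qed.

(** An open set is where the distance to its complement is positive; this
    distance is taken in the sup norm, which is at most the Euclidean norm. *)
Lemma open_caratheodory (U : set E) : open U -> mu.-caratheodory U.
Proof.
move=> oU; have [[y0 Uy0]|] := pselect ((~` U) !=set0); last first.
  move=> /set0P/negP; rewrite negbK => /eqP U0.
  rewrite -(setCK U) U0; apply: caratheodory_measurable_setC.
  exact: caratheodory_measurable_set0.
pose dist x := inf [set `|x - y| | y in ~` U].
have lb x : lbound [set `|x - y| | y in ~` U] 0.
  by move=> _ [y _ <-]; exact: normr_ge0.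
have ne x : [set `|x - y| | y in ~` U] !=set0 by exists `|x - y0|, y0.
have -> : U = [set x | 0 < dist x].
  apply/seteqP; split => x /=.
    move: oU; rewrite openE => /[apply] /nbhs_normP[e /= e0 eU].
    apply: lt_le_trans e0 _; apply: lb_le_inf => // _ [y Uy <-].
    rewrite leNgt; apply/negP => xy; apply: Uy; apply: eU.
    by rewrite /ball_ /=.
  move=> d0; apply: contrapT => Ux.
  have : dist x <= 0.
    by apply: ge_inf; [exists 0; exact: lb|exists x => //; rewrite subrr normr0].
  by rewrite leNgt d0.
apply: lipschitz_caratheodory => x y.
rewrite lerBlDr -lerBlDl; apply: lb_le_inf => // _ [z Uz <-].
rewrite lerBlDl; apply: le_trans (_ : `|x - z| <= _).
  by apply: ge_inf; [exists 0; exact: lb|exists z].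
by apply: le_trans (ler_distD y _ _) _; rewrite lerD2r mx_norm_le_enorm.
Qed.

Lemma borel_caratheodory (A : set (borel_rV R n)) : measurable A ->
  mu.-caratheodory A.
Proof.
apply: smallest_sub; last exact: open_caratheodory.
split; first exact: caratheodory_measurable_set0.
  by move=> B mB; rewrite setTD; exact: caratheodory_measurable_setC.
exact: caratheodory_measurable_bigcup.
Qed.

End MetricOuterMeasure.

Section HausdorffMeasure.
Context {R : realType} {n : nat}.
Variable s : nat.
Local Notation H := (hausdorff s.+1 : set (borel_rV R n) -> \bar R).

Let hausdorff_sigma_additive : semi_sigma_additive H.
Proof.
move=> F mF tF mUF.
have bc := @borel_caratheodory R n (hausdorff s.+1) (@hausdorff_separated R n s).
apply: (@caratheodory_measure_sigma_additive R 'rV[R]_n (hausdorff s.+1) F) => //.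
  by move=> i; exact: bc.
exact: bc.
Qed.

HB.instance Definition _ := isMeasure.Build _ _ _ H
  (outer_measure0 (hausdorff s.+1 : set 'rV[R]_n -> \bar R))
  (outer_measure_ge0 (hausdorff s.+1 : set 'rV[R]_n -> \bar R))
  hausdorff_sigma_additive.

End HausdorffMeasure.

(** * Reflections and the sphere *)

Section Isometries.
Context {R : realType} {n : nat}.
Local Notation E := 'rV[R]_n.
Implicit Types (x y u v : E) (A : set E).

Lemma enorm_le_sum x : enorm x <= \sum_i `|x 0 i|.
Proof.
have s0 : 0 <= \sum_i `|x 0 i| by apply: sumr_ge0.
rewrite -(ler_pXn2r (n := 2))// ?nnegrE ?enorm_ge0//.
rewrite enorm_sqr expr2 mulr_suml; apply: ler_sum => i _.
rewrite -expr2 -(real_normK (num_real _)) expr2 ler_wpM2l//.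
by rewrite (bigD1 i)//= lerDl sumr_ge0.
Qed.

Lemma enorm_le_mx_norm x : enorm x <= n%:R * `|x|.
Proof.
apply: le_trans (enorm_le_sum x) _.
have -> : n%:R * `|x| = \sum_(i < n) `|x| by rewrite sumr_const card_ord mulr_natl.
apply: ler_sum => i _.
rewrite [leRHS]mx_normrE; exact: (le_bigmax _ (fun ij => `|x ij.1 ij.2|) (0, i)).
Qed.

Lemma lipschitz_open_preimage (V : normedModType R) (f : E -> V) K (U : set V) :
  0 < K -> (forall x y, `|f x - f y| <= K * `|x - y|) -> open U ->
  open (f @^-1` U).
Proof.
move=> K0 fK oU; rewrite openE => x /= Ufx.
move: oU; rewrite openE => /(_ _ Ufx)/nbhs_normP[e /= e0 eU].
suff : nbhs x (f @^-1` U) by [].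
apply/(@nbhs_normP R E x (f @^-1` U)); exists (e / K) => /=; first by rewrite divr_gt0.
move=> y /=; rewrite /ball_ /= ltr_pdivlMr// mulrC => xy.
by apply: eU; rewrite /ball_ /=; exact: le_lt_trans (fK _ _) xy.
Qed.

Lemma measurable_coord i : measurable_fun setT (fun x : borel_rV R n => x 0 i).
Proof.
apply: (measurability _ (RGenOInfty.measurableE R)).
move=> _ [_ [a ->] <-]; rewrite setTI preimage_itvoy.
apply: sub_sigma_algebra.
have -> : [set x : borel_rV R n | a < x 0 i] =
    (fun x : E => x 0 i : R^o) @^-1` [set t | a < t] by [].
have oa : open [set t : R^o | a < t] by exact: open_gt.
apply: (lipschitz_open_preimage (K := 1) _ _ oa) => // x y; rewrite mul1r.
have -> : x 0 i - y 0 i = (x - y) 0 i by rewrite !mxE.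
rewrite [leRHS]mx_normrE.
exact: (le_bigmax _ (fun ij => `|(x - y) ij.1 ij.2|) (0, i)).
Qed.

Lemma measurable_dotp d (T : measurableType d) (f g : T -> borel_rV R n) :
  measurable_fun setT f -> measurable_fun setT g ->
  measurable_fun setT (fun t => dotp (f t) (g t)).
Proof.
move=> mf mg; apply: measurable_sum => i.
apply: measurable_funM.
  exact: (measurableT_comp (measurable_coord i) mf).
exact: (measurableT_comp (measurable_coord i) mg).
Qed.

Section Involution.
Variable g : E -> E.
Hypotheses (gK : involutive g)
  (gE : forall x y, enorm (g x - g y) = enorm (x - y)).

Lemma measurable_isometry : measurable_fun setT (g : borel_rV R n -> borel_rV R n).
Proof.
apply: (@measurability _ _ (borel_rV R n) (borel_rV R n) setT g (@open _)) => //.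
move=> _ [U oU <-].
rewrite setTI; apply: sub_sigma_algebra.
apply: (lipschitz_open_preimage (K := n%:R + 1)) => //.
move=> x y; apply: le_trans (mx_norm_le_enorm _) _.
rewrite gE; apply: le_trans (enorm_le_mx_norm _) _.
by rewrite ler_wpM2r// lerDl.
Qed.

Let ediam_preimage A : (ediam (g @^-1` A) <= ediam A)%E.
Proof.
apply: ge_ereal_sup => _ [->|[[u v] [/= Au Av] <-]]; first exact: ediam_ge0.
by rewrite -gE; exact: ediam_ge.
Qed.

Let lee_expe (x y : \bar R) k : (0 <= x)%E -> (x <= y)%E -> (x ^+ k <= y ^+ k)%E.
Proof.
move=> x0 xy; elim: k => [//|k ih].
by rewrite !expeS lee_pmul// expe_ge0.
Qed.

Let hausdorff_preimage_le s A :
  (hausdorff s.+1 (g @^-1` A) <= hausdorff s.+1 A)%E.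
Proof.
apply: ge_ereal_sup => _ [delta d0 <-].
apply: le_trans (hausdorff_pre_le _ _ d0).
apply: le_ereal_inf_tmp => _ [F [AF Fd] <-].
apply: (@le_trans _ _ (\sum_(k <oo) gauge s (g @^-1` F k))%E).
  apply: ereal_inf_lbound; exists (fun k => g @^-1` F k) => //; split.
    by move=> x /AF[k _ Fx]; exists k.
  by move=> k; exact: le_trans (ediam_preimage _) (Fd k).
apply: lee_nneseries => [k _ _|k _]; first exact: gauge_ge0.
apply: lee_pmul => //; last by apply: lee_expe => //; exact: ediam_ge0.
  by rewrite lee_fin divr_ge0// ?exprn_ge0// ltW// ball_volume_gt0.
exact/expe_ge0/ediam_ge0.
Qed.

Lemma hausdorff_preimage s A : hausdorff s.+1 (g @^-1` A) = hausdorff s.+1 A.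
Proof.
apply/eqP; rewrite eq_le hausdorff_preimage_le /=.
have {1}-> : A = g @^-1` (g @^-1` A).
  by apply/seteqP; split => x /=; rewrite gK.
exact: hausdorff_preimage_le.
Qed.

End Involution.

(** The reflection in the hyperplane orthogonal to [v]; the identity when
    [v = 0], since division by zero yields zero. *)
Definition reflection v x : E := x - (2 * dotp x v / dotp v v) *: v.

Lemma dotp_eq0 v : dotp v v = 0 -> v = 0.
Proof.
move=> v0; apply/rowP => i; rewrite mxE; apply/eqP.
by rewrite -normr_le0; apply: le_trans (coord_le_enorm v i) _; rewrite /enorm v0 sqrtr0.
Qed.

Lemma reflectionB v x y : reflection v x - reflection v y = reflection v (x - y).
Proof.
rewrite /reflection dotpBl mulrBr mulrBl scalerBl opprB !opprD !addrA.
by rewrite opprK addrAC -!addrA; congr (_ + _); rewrite addrCA addrA addrC.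
Qed.

Lemma dotp_reflection v x y : dotp (reflection v x) (reflection v y) = dotp x y.
Proof.
rewrite /reflection; have [/dotp_eq0 ->|v0] := eqVneq (dotp v v) 0.
  by rewrite !scaler0 !subr0.
rewrite dotpBl !dotpBr !dotpZl !dotpZr (dotpC v y).
by field.
Qed.

Lemma reflectionK v : involutive (reflection v).
Proof.
move=> x; rewrite {1}/reflection; have [/dotp_eq0 ->|v0] := eqVneq (dotp v v) 0.
  by rewrite scaler0 subr0 /reflection scaler0 subr0.
have -> : dotp (reflection v x) v = - dotp x v.
  by rewrite /reflection dotpBl dotpZl; field.
by rewrite /reflection mulrN mulNr scaleNr opprK subrK.
Qed.

Lemma enorm_reflection v x y :
  enorm (reflection v x - reflection v y) = enorm (x - y).
Proof. by rewrite reflectionB /enorm dotp_reflection. Qed.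

Lemma reflection_swap u v : dotp u u = dotp v v -> reflection (u - v) u = v.
Proof.
move=> uv; rewrite /reflection; have [z|nz] := eqVneq (dotp (u - v) (u - v)) 0.
  by rewrite z invr0 mulr0 scale0r subr0; apply: subr0_eq; exact: dotp_eq0.
suff -> : 2 * dotp u (u - v) / dotp (u - v) (u - v) = 1 by rewrite scale1r subKr.
suff -> : 2 * dotp u (u - v) = dotp (u - v) (u - v) by rewrite divff.
by rewrite dotpBl !dotpBr (dotpC v u) -uv; ring.
Qed.

Lemma reflection_fix v x : dotp x v = 0 -> reflection v x = x.
Proof. by move=> xv; rewrite /reflection xv mulr0 mul0r scale0r subr0. Qed.

(** Two-point homogeneity: two reflections move any pair of points to any other
    pair with the same inner products. *)
Lemma reflection_invariant_two_points (k : E -> E -> R) u v u' v' :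
  (forall w x y, k (reflection w x) (reflection w y) = k x y) ->
  dotp u u = dotp u' u' -> dotp v v = dotp v' v' -> dotp u v = dotp u' v' ->
  k u v = k u' v'.
Proof.
move=> kr uu vv uv; rewrite -(kr (u - u')) reflection_swap//.
set v1 := reflection (u - u') v.
have v1v1 : dotp v1 v1 = dotp v' v' by rewrite dotp_reflection.
have u'v1 : dotp u' v1 = dotp u' v'.
  by rewrite -[in LHS](reflection_swap uu) dotp_reflection.
rewrite -(kr (v1 - v')) reflection_swap// reflection_fix//.
by rewrite dotpBr u'v1 subrr.
Qed.

End Isometries.

Section SphereBasics.
Context {R : realType} {d : nat}.
Local Notation E := 'rV[R]_d.+1.
Implicit Types u v w : E.

Lemma sphereE u : sphere u <-> dotp u u = 1.
Proof.
split=> [/= Su|Su]; first by rewrite -enorm_sqr Su expr1n.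
by rewrite /sphere /= /enorm Su sqrtr1.
Qed.

Lemma measurable_sphere : measurable (@sphere R d : set (borel_rV R d.+1)).
Proof.
have mq : measurable_fun setT (fun w : borel_rV R d.+1 => dotp w w).
  by apply: measurable_dotp; exact: measurable_id.
have := mq measurableT [set 1] (measurable_set1 _); rewrite setTI.
congr (measurable _); apply/seteqP; split => w /=; by rewrite sphereE.
Qed.

Lemma dotp_sphere_itv u v : sphere u -> sphere v -> -1 <= dotp u v <= 1.
Proof.
move=> /sphereE uu /sphereE vv.
have H1 := dotp_ge0 (u - v); have H2 := dotp_ge0 (u + v).
rewrite dotpBl !dotpBr uu vv (dotpC v u) in H1.
rewrite dotpDl !dotpDr uu vv (dotpC v u) in H2.
by apply/andP; split; lra.
Qed.

Lemma sphere_reflection v w : sphere (reflection v w) <-> sphere w.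
Proof. by rewrite !sphereE dotp_reflection. Qed.

End SphereBasics.

(** * The sphere has finite measure *)

Section FiniteCovers.
Context {R : realType} {n : nat}.
Variable s : nat.
Local Notation E := 'rV[R]_n.

Lemma gauge_cst_gt0 : 0 < ball_volume s.+1 / 2 ^+ s.+1 :> R.
Proof. by rewrite divr_gt0 ?ball_volume_gt0// exprn_gt0. Qed.

Lemma gaugeE (A : set E) (r : R) : ediam A = r%:E ->
  gauge s A = (ball_volume s.+1 / 2 ^+ s.+1 * r ^+ s.+1)%:E.
Proof. by move=> Ar; rewrite /gauge Ar -EFin_expe -EFinM. Qed.

Lemma ediam_fin (A : set E) (b : R) : (ediam A <= b%:E)%E ->
  exists2 r, 0 <= r <= b & ediam A = r%:E.
Proof.
move: (ediam_ge0 A); case: (ediam A) => [r| |] //; rewrite !lee_fin => r0 rb.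
by exists r => //; rewrite r0.
Qed.

Lemma hausdorff_pre_finite_cover (I : finType) (P : I -> set E) (A : set E)
    (b delta : R) : 0 <= b -> b <= delta ->
  (forall i, (ediam (P i) <= b%:E)%E) -> (forall x, A x -> exists i, P i x) ->
  (hausdorff_pre s.+1 delta A <=
   (#|I|%:R * (ball_volume s.+1 / 2 ^+ s.+1 * b ^+ s.+1))%:E)%E.
Proof.
move=> b0 bd Pb AP.
pose F k := nth set0 [seq P i | i <- enum I] k.
have sF : size [seq P i | i <- enum I] = #|I| by rewrite size_map cardE.
have Fb k : (ediam (F k) <= b%:E)%E.
  have [Ik|kI] := leqP #|I| k.
    by rewrite /F nth_default ?sF// ediam0 lee_fin.
  have : F k \in [seq P i | i <- enum I] by rewrite mem_nth// sF.
  by move=> /mapP[i _ ->].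
apply: (@le_trans _ _ (\sum_(k <oo) gauge s (F k))%E).
  apply: ereal_inf_lbound; exists F => //; split; last first.
    by move=> k; apply: le_trans (Fb k) _; rewrite lee_fin.
  move=> x /AP[i Pix].
  have iI : (index i (enum I) < size (enum I))%N by rewrite index_mem mem_enum.
  by exists (index i (enum I)) => //; rewrite /F (nth_map i)// nth_index// mem_enum.
rewrite (nneseries_split 0 #|I|); last by move=> k _; exact: gauge_ge0.
rewrite [X in (_ + X)%E]eseries0 ?adde0 ?add0n; last first.
  by move=> k Ik _; rewrite /F nth_default ?sF// gauge0.
rewrite big_mkord.
apply: (@le_trans _ _ (\sum_(k < #|I|)
    (ball_volume s.+1 / 2 ^+ s.+1 * b ^+ s.+1)%:E)%E).
  apply: lee_sum => k _; have [r /andP[r0 rb] Fr] := ediam_fin (Fb k).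
  rewrite (gaugeE Fr) lee_fin ler_wpM2l ?(ltW gauge_cst_gt0)//.
  by rewrite lerXn2r// nnegrE.
by rewrite sumEFin lee_fin sumr_const card_ord mulr_natl.
Qed.

End FiniteCovers.

Section SphereFinite.
Context {R : realType}.
Variable s : nat.
Local Notation E := 'rV[R]_s.+2.
Local Notation n := s.+2.

Section Patches.
Variable m : nat.
Let M := m.+1.

Definition patch_index : finType := ('I_n * bool * {ffun 'I_s.+1 -> 'I_M.+1})%type.

(** On the part of the sphere where the [i]-th coordinate is bounded away from
    zero and has a fixed sign, the other coordinates are a Lipschitz chart;
    the patch is the preimage of a cell of a grid of mesh [2 / M]. *)
Definition patch (q : patch_index) : set E := [set x | [/\ sphere x,
  n%:R^-1 <= (-1) ^+ q.1.2 * x 0 q.1.1 &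
  forall j, (q.2 j)%:R <= M%:R * (x 0 (lift q.1.1 j) + 1) / 2 < (q.2 j).+1%:R]].

Lemma sphere_coord_bound (x : E) j : sphere x -> `|x 0 j| <= 1.
Proof. by move=> <-; exact: coord_le_enorm. Qed.

Lemma patch_cover (x : E) : sphere x -> exists q, patch q x.
Proof.
move=> Sx.
have [i xi] : exists i, n%:R^-1 <= `|x 0 i|.
  apply: contrapT => /forallNP H.
  have lt1 i : x 0 i * x 0 i < n%:R^-1.
    have xi : `|x 0 i| < n%:R^-1 by rewrite ltNge; exact/negP/H.
    rewrite -expr2 -(real_normK (num_real _)) expr2.
    apply: le_lt_trans xi; rewrite ler_piMr//; exact: sphere_coord_bound.
  have /sphereE := Sx; rewrite /dotp => S1.
  have : \sum_(i < n) x 0 i * x 0 i < \sum_(i < n) n%:R^-1.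
    by apply: ltr_sum => //; apply/hasP; exists ord0 => //; rewrite mem_index_enum.
  by rewrite S1 sumr_const card_ord -[_^-1 *+ _]mulr_natl divff// ltxx.
have [b xb] : exists b : bool, n%:R^-1 <= (-1) ^+ b * x 0 i.
  have [x0|x0] := leP 0 (x 0 i).
    by exists false; rewrite expr0 mul1r -(ger0_norm x0).
  by exists true; rewrite expr1 mulN1r -(ltr0_norm x0).
pose t j := M%:R * (x 0 (lift i j) + 1) / 2.
have tb j : 0 <= t j <= M%:R.
  have := sphere_coord_bound (lift i j) Sx; rewrite ler_norml => /andP[l u].
  rewrite /t divr_ge0 ?mulr_ge0//=; last by rewrite -lerBlDr sub0r.
  by rewrite ler_pdivrMr// ler_wpM2l// -lerBrDr (_ : 2 - 1 = 1)//; ring.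
have tn j : (Num.trunc (t j) < M.+1)%N.
  have /andP[t0 tM] := tb j; rewrite ltnS -(ler_nat R).
  by have /andP[+ _] := truncn_itv t0 => /le_trans; apply.
exists (i, b, [ffun j => Ordinal (tn j)]); split => // j /=.
by rewrite ffunE /=; have /andP[t0 _] := tb j; exact: truncn_itv.
Qed.

Let K : R := 2 * s.+1%:R * (1 + n%:R).

Lemma patch_diam q : (ediam (patch q) <= (K / M%:R)%:E)%E.
Proof.
case: q => [[i b] c].
have M0 : 0 < M%:R :> R by [].
apply: ediam_le => [|x y [Sx xi xc] [Sy yi yc]].
  by rewrite divr_ge0// !mulr_ge0// addr_ge0.
rewrite /= in xi yi xc yc.
have dj j : `|x 0 (lift i j) - y 0 (lift i j)| <= 2 / M%:R.
  have /andP[x1 x2] := xc j; have /andP[y1 y2] := yc j.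
  have H : `|M%:R * (x 0 (lift i j) + 1) / 2 - M%:R * (y 0 (lift i j) + 1) / 2| <= 1.
    have cS : (c j).+1%:R = (c j)%:R + 1 :> R by rewrite natr1.
    rewrite cS in x2 y2; rewrite ler_norml; apply/andP; split; lra.
  have -> : x 0 (lift i j) - y 0 (lift i j) = 2 / M%:R *
      (M%:R * (x 0 (lift i j) + 1) / 2 - M%:R * (y 0 (lift i j) + 1) / 2).
    by field; rewrite gt_eqF.
  have M2 : 0 <= 2 / M%:R :> R by rewrite divr_ge0.
  by rewrite normrM (ger0_norm M2) ler_piMr.
have sq j : `|y 0 (lift i j) * y 0 (lift i j) - x 0 (lift i j) * x 0 (lift i j)| <= 4 / M%:R.
  have -> : y 0 (lift i j) * y 0 (lift i j) - x 0 (lift i j) * x 0 (lift i j) =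
    (x 0 (lift i j) - y 0 (lift i j)) * (- (x 0 (lift i j) + y 0 (lift i j))) by ring.
  rewrite normrM normrN (_ : 4 / M%:R = 2 / M%:R * 2); last by field; rewrite gt_eqF.
  apply: ler_pM => //; apply: le_trans (ler_normD _ _) _.
  have := sphere_coord_bound (lift i j) Sx.
  have := sphere_coord_bound (lift i j) Sy; lra.
have split_sum (F : 'I_n -> R) : \sum_k F k = F i + \sum_(j < s.+1) F (lift i j).
  exact: bigD1_ord.
have di : `|x 0 i - y 0 i| <= 2 * n%:R * s.+1%:R / M%:R.
  (* The two points have equal norms, and their [i]-th coordinates the same sign. *)
have E1 : (x 0 i - y 0 i) * (x 0 i + y 0 i) =
      \sum_(j < s.+1) (y 0 (lift i j) * y 0 (lift i j) -
                       x 0 (lift i j) * x 0 (lift i j)).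
    have /sphereE := Sx; have /sphereE := Sy; rewrite /dotp !split_sum sumrB.
    by move=> H1 H2; rewrite -subr_sqr !expr2; lra.
  have E2 : `|x 0 i - y 0 i| * (2 / n%:R) <= s.+1%:R * (4 / M%:R).
    apply: (@le_trans _ _ (`|(x 0 i - y 0 i) * (x 0 i + y 0 i)|)).
      rewrite normrM ler_wpM2l//.
      have -> : `|x 0 i + y 0 i| = `|(-1) ^+ b * x 0 i + (-1) ^+ b * y 0 i|.
        by rewrite -mulrDr normrM normr_sign mul1r.
      rewrite -[2 / n%:R](_ : n%:R^-1 + n%:R^-1 = _); last by ring.
      apply: le_trans (ler_norm _); exact: lerD.
    rewrite E1; apply: le_trans (ler_norm_sum _ _ _) _.
    apply: (@le_trans _ _ (\sum_(j < s.+1) (4 / M%:R))); first exact: ler_sum.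
    by rewrite sumr_const card_ord -[leLHS]mulr_natl.
  have n0 : 0 < (2 / n%:R : R) by [].
  rewrite -(ler_pM2r n0); apply: le_trans E2 _.
  rewrite le_eqVlt; apply/orP; left; apply/eqP.
  by field; rewrite !gt_eqF.
apply: le_trans (enorm_le_sum _) _.
rewrite split_sum !mxE.
apply: (@le_trans _ _ (2 * n%:R * s.+1%:R / M%:R + \sum_(j < s.+1) (2 / M%:R))).
  apply: lerD => //; apply: ler_sum => j _; rewrite !mxE; exact: dj.
rewrite sumr_const card_ord -[_ *+ s.+1]mulr_natl /K le_eqVlt; apply/orP; left; apply/eqP.
by field; rewrite gt_eqF.
Qed.

End Patches.

(** The number of patches grows like [M ^ (s + 1)] while their diameters decrease
    like [1 / M], so the sums stay bounded as the patches shrink. *)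
Lemma hausdorff_sphere_finite : (hausdorff s.+1 (@sphere R s.+1) < +oo)%E.
Proof.
pose K : R := 2 * s.+1%:R * (1 + n%:R).
have K0 : 0 <= K by rewrite !mulr_ge0// addr_ge0.
pose B : R := n%:R * 2 * (ball_volume s.+1 / 2 ^+ s.+1 * (2 * K) ^+ s.+1).
apply: (@le_lt_trans _ _ B%:E); last exact: ltry.
apply: ge_ereal_sup => _ [delta d0 <-].
pose m := Num.bound (K / delta).
have M0 : 0 < m.+1%:R :> R by [].
have md : K / m.+1%:R <= delta.
  rewrite ler_pdivrMr// mulrC -ler_pdivrMr//.
  apply: ltW; apply: lt_trans (archi_boundP _) _; first by rewrite divr_ge0// ltW.
  by rewrite ltr_nat.
apply: le_trans (hausdorff_pre_finite_cover s _ md (@patch_diam m) (@patch_cover m)) _.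
  by rewrite divr_ge0.
rewrite lee_fin /B !card_prod card_ord card_bool card_ffun !card_ord !natrM natrX.
set a := ball_volume _ / _; set p := _ ^+ _; set q := (K / _) ^+ _.
have pq : p * q <= (2 * K) ^+ s.+1.
  rewrite -exprMn lerXn2r ?nnegrE ?mulr_ge0 ?divr_ge0//.
  rewrite mulrCA mulrC ler_wpM2r// ler_pdivrMr// -natrM ler_nat.
  by rewrite ltn_Pmull.
have -> : n%:R * 2 * p * (a * q) = n%:R * 2 * a * (p * q) by ring.
rewrite [leRHS]mulrA ler_wpM2l// mulr_ge0//.
by rewrite ltW// gauge_cst_gt0.
Qed.

End SphereFinite.

(** * Spherical caps have positive measure *)

Section BoxCover.
Context {R : realType}.

(** By induction on the dimension [m]: each slice of [0, a]^m orthogonal to the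
    last axis satisfies the bound, with weights recording which cubes meet the
    slice, and these bounds are integrated along the axis. *)
Lemma box_cover_volume m (a b : R) (w r : nat -> R) (c : nat -> nat -> R) :
  0 < a -> 0 <= b -> (forall k, 0 <= w k) -> (forall k, 0 <= r k) ->
  (forall y : nat -> R, (forall i, (i < m)%N -> 0 <= y i <= a) ->
    (b%:E <= \sum_(k <oo) (w k *
      \prod_(i < m) \1_(`[c k i - r k, c k i + r k]%classic) (y i))%:E)%E) ->
  ((b * a ^+ m)%:E <= \sum_(k <oo) (w k * (2 * r k) ^+ m)%:E)%E.
Proof.
move=> a0 b0 w0 r0; elim: m w w0 => [|m ih] w w0 cov.
  rewrite expr0 mulr1; apply: le_trans (cov (fun=> 0) _) _ => //.
  apply: lee_nneseries => [k _ _|k _]; rewrite big_ord0 ?expr0// lee_fin.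
  by rewrite mulr1.
pose I k := `[c k m - r k, c k m + r k]%classic : set R.
have ind0 k (t : R) : 0 <= \1_(I k) t :> R by rewrite indicE.
have slice t : 0 <= t <= a ->
    ((b * a ^+ m)%:E <= \sum_(k <oo) (w k * \1_(I k) t * (2 * r k) ^+ m)%:E)%E.
  move=> ta; apply: ih => [k|y ya]; first by rewrite mulr_ge0.
  pose y' i := if (i < m)%N then y i else t.
  have /cov : forall i, (i < m.+1)%N -> 0 <= y' i <= a.
    by move=> i _; rewrite /y'; case: ifPn => // im; exact: ya.
  move/le_trans; apply; apply: lee_nneseries => [k _ _|k _]; rewrite lee_fin.
    by rewrite mulr_ge0// prodr_ge0// => i _; rewrite indicE.
  rewrite big_ord_recr /= {2}/y' ltnn -/(I k) -mulrA [\1_(I k) t * _]mulrC.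
  rewrite le_eqVlt; apply/orP; left; apply/eqP; congr (_ * (_ * _)).
  by apply: eq_bigr => i _; rewrite /y' ltn_ord.
pose A : set R := `[0, a]%classic.
have mA : measurable A by exact: measurable_itv.
pose g k (t : R) := ((w k * (2 * r k) ^+ m)%:E * (\1_(I k) t)%:E)%E.
have g0 k t : A t -> (0 <= g k t)%E.
  by move=> _; rewrite /g -EFinM lee_fin !mulr_ge0// exprn_ge0// mulr_ge0.
have mI k : measurable (I k) by exact: measurable_itv.
have mind k : measurable_fun A (fun t => (\1_(I k) t)%:E).
  by apply/measurable_EFinP; exact: measurable_indic.
have mg k : measurable_fun A (g k) by apply: emeasurable_funM.
have E1 : (b * a ^+ m.+1)%:E =
    (\int[lebesgue_measure]_(t in A) (b * a ^+ m)%:E)%E.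
  rewrite integral_cst//= lebesgue_measure_itv /= lte_fin a0.
  by rewrite sube0 -EFinM exprSr mulrA.
rewrite E1; apply: (@le_trans _ _
    (\int[lebesgue_measure]_(t in A) (\sum_(k <oo) g k t))%E).
  apply: ge0_le_integral => //=.
  - by move=> t _; rewrite lee_fin mulr_ge0// exprn_ge0// ltW.
  - by apply: ge0_emeasurable_sum => [k t ta _|k _]; [exact: g0|exact: mg].
  - move=> t; rewrite /A /= in_itv /= => /slice /le_trans; apply.
    rewrite le_eqVlt; apply/orP; left; apply/eqP; apply: eq_eseriesr => k _.
    by rewrite /g -EFinM mulrAC.
rewrite integral_nneseries//=; apply: lee_nneseries => [k _ _|k _].
  by apply: integral_ge0 => t ta; exact: g0.
have wr0 : 0 <= w k * (2 * r k) ^+ m by rewrite mulr_ge0// exprn_ge0// mulr_ge0.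
rewrite /g ge0_integralZl_EFin//; last exact: mind.
rewrite exprSr [in leRHS]mulrA [leRHS]EFinM.
apply: lee_pmul => //; first by apply: integral_ge0 => t _; rewrite lee_fin.
apply: (@le_trans _ _ (lebesgue_measure (I k `&` A))).
  have := @integral_indic _ _ R (@lebesgue_measure R) A mA (I k) (mI k).
  by move=> ->.
apply: (@le_trans _ _ (lebesgue_measure (I k))).
  apply: le_measure; last exact: subIsetl.
    by rewrite inE; exact: (measurableI _ _ (mI k) mA).
  by rewrite inE; exact: (mI k).
rewrite lebesgue_measure_itv /= lte_fin; case: ifP => _; last first.
  by rewrite lee_fin mulr_ge0.
by rewrite -EFinB lee_fin le_eqVlt; apply/orP; left; apply/eqP; ring.
Qed.

End BoxCover.

Section SphereCaps.
Context {R : realType}.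
Variable s : nat.
Local Notation E := 'rV[R]_s.+2.

Definition cap (v : E) (h : R) : set E := [set w | sphere w /\ 1 - h <= dotp w v].

Let pole : E := delta_mx 0 0.

Let dotp_pole w : dotp w pole = w 0 0.
Proof.
rewrite /dotp big_ord_recl /pole mxE !eqxx mulr1 big1 ?addr0// => i _.
by rewrite mxE andbC mulr0.
Qed.

Let sphere_pole : sphere pole.
Proof. by apply/sphereE; rewrite dotp_pole mxE. Qed.

(** The orthogonal projection along the pole maps the cap onto a set that
    contains a cube, and it does not increase diameters. *)
Let hausdorff_polar_cap_gt0 h : 0 < h -> (0 < hausdorff s.+1 (cap pole h))%E.
Proof.
move=> h0; pose m := Num.min h 1.
have m0 : 0 < m by rewrite lt_min h0 ltr01.
have m1 : m <= 1 by rewrite ge_min lexx orbT.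
have mh : m <= h by rewrite ge_min lexx.
pose a : R := m / s.+1%:R.
have a0 : 0 < a by rewrite divr_gt0.
pose b : R := ball_volume s.+1 / 2 ^+ s.+1 / 2 ^+ s.+1.
have b0 : 0 < b by rewrite divr_gt0 ?exprn_gt0// gauge_cst_gt0.
apply: (@lt_le_trans _ _ (b * a ^+ s.+1)%:E).
  by rewrite lte_fin mulr_gt0// exprn_gt0.
apply: le_trans (hausdorff_pre_le _ _ (ltr01 : 0 < 1 :> R)).
apply: le_ereal_inf_tmp => _ [F [capF F1] <-].
pose r k := fine (ediam (F k)).
have rE k : ediam (F k) = (r k)%:E /\ 0 <= r k.
  by have [t /andP[t0 _] Ft] := ediam_fin (F1 k); rewrite /r Ft.
pose c k i : R := (xget 0 (F k)) 0 (inord i.+1).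
rewrite (_ : (fun n => _) = fun n => \sum_(0 <= k < n) (b * (2 * r k) ^+ s.+1)%:E)%E; last first.
  apply/funext => j; apply: eq_bigr => k _.
  rewrite -[LHS]/(gauge s (F k)) (gaugeE s (rE k).1) exprMn /b; congr _%:E.
  by field; rewrite expf_neq0.
apply: (@box_cover_volume R s.+1 a b (fun=> b) r c) => //.
- exact: ltW.
- by move=> _; exact: ltW.
- by move=> k; exact: (rE k).2.
move=> y ya.
pose q := \sum_(i < s.+1) y i * y i.
have q0 : 0 <= q by apply: sumr_ge0 => i _; rewrite -expr2 sqr_ge0.
have qm : q <= m.
  apply: (@le_trans _ _ (\sum_(i < s.+1) a * a)).
    by apply: ler_sum => i _; have /andP[? ?] := ya i (ltn_ord i); exact: ler_pM.
  rewrite sumr_const card_ord -[leLHS]mulr_natl.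
  rewrite (_ : _ * (a * a) = m * a); last by rewrite /a; field.
  rewrite ler_piMr ?(ltW m0)// /a ler_pdivrMr// mul1r.
  by apply: le_trans m1 _; rewrite ler1n.
pose z := Num.sqrt (1 - q).
have q1 : 0 <= 1 - q by rewrite subr_ge0 (le_trans qm).
pose x : E := \row_j (if j == 0 then z else y j.-1).
have x0 : x 0 0 = z by rewrite mxE.
have xS i : x 0 (lift ord0 i) = y i by rewrite mxE.
have Sx : sphere x.
  apply/sphereE; rewrite /dotp big_ord_recl x0 -expr2 sqr_sqrtr//.
  rewrite (eq_bigr (fun i : 'I_s.+1 => y i * y i)) ?subrK//.
  by move=> i _; rewrite xS.
have capx : cap pole h x.
  split => //; rewrite dotp_pole x0 /z.
  apply: (@le_trans _ _ (1 - q)); first by rewrite lerD2l lerN2 (le_trans qm).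
  rewrite -{1}(ger0_norm q1) -sqrtr_sqr ler_wsqrtr// expr2 ler_piMr//.
  by rewrite gerBl.
have [k _ Fkx] := capF _ capx.
have Fp : F k (xget 0 (F k)) by apply: xgetPex; exists x.
apply: (@le_trans _ _ (b * \prod_(i < s.+1)
    \1_(`[c k i - r k, c k i + r k]%classic) (y i))%:E).
  rewrite big1 ?mulr1// => i _.
  rewrite indicE (_ : _ \in _ = true)//; apply/mem_set => /=.
  rewrite in_itv /= -ler_distlC.
  have -> : c k i = (xget 0 (F k)) 0 (lift ord0 i).
    by rewrite /c; congr (_ 0 _); apply: val_inj; rewrite /= inordK// ltnS ltn_ord.
  rewrite -xS -lee_fin -(rE k).1; apply: le_trans (ediam_ge Fp Fkx).
  rewrite lee_fin; apply: le_trans (coord_le_enorm _ (lift ord0 i)).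
  by rewrite !mxE.
have term0 j : (0 <= (b * \prod_(i < s.+1)
    \1_(`[c j i - r j, c j i + r j]%classic) (y i))%:E)%E.
  by rewrite lee_fin mulr_ge0 ?(ltW b0)// prodr_ge0// => i _; rewrite indicE.
apply: le_trans (nneseries_lim_ge k.+1 _); last by move=> j _ _; exact: term0.
rewrite big_nat_recr//= leeDr//; apply: sume_ge0 => j _; exact: term0.
Qed.

Lemma hausdorff_cap_gt0 v h : sphere v -> 0 < h -> (0 < hausdorff s.+1 (cap v h))%E.
Proof.
move=> Sv h0; pose g := reflection (v - pole).
have gv : g v = pole.
  by apply: reflection_swap; move/sphereE : Sv => ->; move/sphereE : sphere_pole => ->.
have -> : cap v h = g @^-1` cap pole h.
  apply/seteqP; split => w /= [Sw wv].
    by split; [exact/sphere_reflection|rewrite -gv dotp_reflection].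
  by split; [exact/sphere_reflection/Sw|rewrite -gv dotp_reflection in wv].
rewrite (hausdorff_preimage (reflectionK _) (enorm_reflection _)).
exact: hausdorff_polar_cap_gt0.
Qed.

Lemma measurable_cap v h : measurable (cap v h : set (borel_rV R s.+2)).
Proof.
apply: measurableI; first exact: measurable_sphere.
have md : measurable_fun setT (fun w : borel_rV R s.+2 => dotp w v).
  by apply: measurable_dotp; [exact: measurable_id|exact: measurable_cst].
have := md measurableT _ (measurable_itv `[1 - h, +oo[).
rewrite setTI; congr (measurable _); apply/seteqP; split => w /=;
  by rewrite in_itv /= andbT.
Qed.

End SphereCaps.

(** * The convolution root on the sphere *)

Section Restriction.
Context {R : realType} {d} {T : measurableType d}.
Variables (mu : {measure set T -> \bar R}) (D : set T) (mD : measurable D).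
Hypothesis moo : (mu D < +oo)%E.
Let nu : {finite_measure set T -> \bar R} := mfrestr mD moo.

Let nu_out : nu (~` D) = 0%E.
Proof. by rewrite /nu /= /mfrestr /mrestr setICl measure0. Qed.

Let integral_mfrestr_on (f : T -> \bar R) :
  (\int[nu]_(x in D) f x = \int[mu]_(x in D) f x)%E.
Proof.
apply: eq_measure_integral => A mA AD.
by rewrite /nu /= /mfrestr /mrestr setIidl.
Qed.

Lemma integrable_mfrestr (f : T -> \bar R) :
  nu.-integrable setT f -> mu.-integrable D f.
Proof.
move=> /integrableP[mf foo]; apply/integrableP; split.
  exact: measurable_funTS.
rewrite -integral_mfrestr_on; apply: le_lt_trans foo.
apply: ge0_subset_integral => //.
by apply: measurableT_comp.
Qed.

Lemma integral_mfrestr (f : T -> \bar R) : nu.-integrable setT f ->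
  (\int[mu]_(x in D) f x = \int[nu]_x f x)%E.
Proof.
move=> fi; rewrite (negligible_integral (measurableC mD) measurableT fi nu_out).
by rewrite setTD setCK integral_mfrestr_on.
Qed.

End Restriction.

Section SphereKernel.
Context {R : realType}.
Variable s : nat.
Local Notation E := 'rV[R]_s.+2.
Local Notation B := (borel_rV R s.+2).
Variable psi : R -> R.
Hypothesis hpsi : Psi s.+1 psi.

Let nu : {finite_measure set B -> \bar R} :=
  mfrestr (@measurable_sphere R s.+1) (hausdorff_sphere_finite s).
Let sigma : R := fine (nu setT).

Let e0 : E := delta_mx 0 0.

Let sphere_e0 : sphere e0.
Proof.
apply/sphereE; rewrite /dotp (bigD1 0)//= big1 => [|i i0]; rewrite !mxE !eqxx.
  by rewrite mulr1 addr0.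
by rewrite (negbTE i0) mulr0.
Qed.

Let nuE (A : set B) : nu A = hausdorff s.+1 (A `&` @sphere R s.+1).
Proof. by []. Qed.

Let sigma_gt0 : 0 < sigma.
Proof.
have Hpos : (0 < hausdorff s.+1 (@sphere R s.+1))%E.
  apply: lt_le_trans (hausdorff_cap_gt0 sphere_e0 ltr01) _.
  by apply: (le_outer_measure (hausdorff s.+1 : set E -> \bar R)) => w [].
by rewrite /sigma nuE setTI fine_gt0// Hpos hausdorff_sphere_finite.
Qed.

Let geodist_itv (u v : E) : sphere u -> sphere v -> 0 <= geodist u v <= pi.
Proof.
move=> Su Sv; have uv := dotp_sphere_itv Su Sv.
by rewrite /geodist acos_ge0// acos_lepi.
Qed.

Let geodist_refl (u : E) : sphere u -> geodist u u = 0.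
Proof. by move=> /sphereE uu; rewrite /geodist uu acos1. Qed.

(** The scaling makes [X] satisfy the Schur test; the cut-off to the sphere makes
    it bounded and positive definite on the whole space. *)
Let X (u v : B) : R :=
  sigma^-1 * (\1_(@sphere R s.+1) u * \1_(@sphere R s.+1) v) * psi (geodist u v).

Let X_sphere (u v : E) : sphere u -> sphere v -> X u v = sigma^-1 * psi (geodist u v).
Proof.
by move=> Su Sv; rewrite /X !indicE !mem_set// !mulr1.
Qed.

Let X_outl (u v : E) : ~ sphere u -> X u v = 0.
Proof. by move=> Su; rewrite /X !indicE memNset// mul0r mulr0 mul0r. Qed.

Let Xsym : ksym X.
Proof. by move=> u v; rewrite /X /geodist dotpC [\1__ u * _]mulrC. Qed.

Let Xpsd : psd X.
Proof.
have [_ _ ppd] := hpsi => l.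
pose x0 : R * B := (0, e0).
pose c (i : 'I_(size l)) : R := (nth x0 l i).1 * \1_(@sphere R s.+1) (nth x0 l i).2.
pose u (i : 'I_(size l)) : E :=
  if `[< sphere ((nth x0 l i).2 : E) >] then (nth x0 l i).2 else e0.
have Su i : sphere (u i) by rewrite /u; case: asboolP.
have -> : quad X l = sigma^-1 *
    \sum_i \sum_j c i * c j * psi (geodist (u i) (u j)).
  rewrite /quad (big_nth x0) big_mkord mulr_sumr; apply: eq_bigr => i _.
  rewrite (big_nth x0) big_mkord mulr_sumr; apply: eq_bigr => j _.
  rewrite /X /c /u !indicE.
  have [Si|Si] := asboolP (sphere ((nth x0 l i).2 : E)); last first.
    by rewrite (memNset Si) !(mul0r, mulr0).
  have [Sj|Sj] := asboolP (sphere ((nth x0 l j).2 : E)); last first.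
    by rewrite (memNset Sj) !(mul0r, mulr0).
  by rewrite (mem_set Si) (mem_set Sj); ring.
by rewrite mulr_ge0// ?invr_ge0 ?(ltW sigma_gt0)//; exact: ppd.
Qed.

Let Xdiag (u : E) : sphere u -> X u u = sigma^-1.
Proof.
by move=> Su; have [_ psi0 _] := hpsi; rewrite X_sphere// geodist_refl// psi0 mulr1.
Qed.

Let X_le u v : `|X u v| <= sigma^-1.
Proof.
have si : 0 <= sigma^-1 by rewrite invr_ge0 ltW.
have [Su|Su] := pselect (sphere (u : E)); last by rewrite X_outl// normr0.
have [Sv|Sv] := pselect (sphere (v : E)); last by rewrite Xsym X_outl// normr0.
have Q t : 0 <= (t ^+ 2 + 1) * sigma^-1 + 2 * t * X u v.
  have := Xpsd [:: (t, u); (1, v)].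
  rewrite !quad_cons// /quad !big_cons !big_nil /= !Xdiag// (Xsym v u).
  by congr (0 <= _); ring.
rewrite ler_norml; apply/andP; split.
  by have := Q 1; rewrite expr1n; lra.
by have := Q (-1); rewrite sqrrN expr1n; lra.
Qed.

Let measurable_psi_acos : measurable_fun (`[-1, 1]%classic : set R) (psi \o @acos R).
Proof.
have [cpsi _ _] := hpsi.
apply: (measurable_comp (F := `[0, pi]%classic : set R)) => //.
- move=> _ [t /= t1 <-]; rewrite in_itv /= in t1.
  by rewrite in_itv /= acos_ge0// acos_lepi.
- exact: subspace_continuous_measurable_fun.
- apply: (measurable_fun_itv_cc (b0 := false) (b1 := true)).
  apply: open_continuous_measurable_fun; first exact: interval_open.
  move=> t; rewrite inE /= in_itv /= => tt; exact: continuous_acos.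
Qed.

Let bX : bker X.
Proof.
split; last by exists sigma^-1 => -[u v]; exact: X_le.
(* [acos] is continuous on [-1, 1] only, and [dotp] leaves it off the sphere. *)
pose clamp (t : R) := Num.max (-1) (Num.min 1 t).
have clampE u v : sphere (u : E) -> sphere (v : E) -> clamp (dotp u v) = dotp u v.
  move=> Su Sv; have /andP[l r] := dotp_sphere_itv Su Sv.
  by rewrite /clamp min_r// max_r.
have mS : measurable_fun setT (\1_(@sphere R s.+1) : B -> R).
  by apply: measurable_indic; exact: (@measurable_sphere R s.+1).
have -> : (fun p : B * B => X p.1 p.2) = fun p =>
    sigma^-1 * (\1_(@sphere R s.+1) p.1 * \1_(@sphere R s.+1) p.2) *
    (psi \o @acos R) (clamp (dotp p.1 p.2)).
  apply/funext => -[u v] /=.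
  have [Su|Su] := pselect (sphere (u : E)); last first.
    by rewrite X_outl// indicE memNset// mul0r mulr0 mul0r.
  have [Sv|Sv] := pselect (sphere (v : E)); last first.
    by rewrite Xsym X_outl// [\1__ v]indicE memNset// !mulr0 mul0r.
  by rewrite clampE.
apply: measurable_funM.
  apply: measurable_funM; first exact: measurable_cst.
  by apply: measurable_funM; apply: (measurableT_comp mS).
apply: (measurable_comp (F := `[-1, 1]%classic : set R)) => //.
- move=> _ [p _ <-]; rewrite /= in_itv /= /clamp le_max lexx /= ge_max.
  by rewrite ge_min lexx (@le_trans _ _ 0).
- apply: measurable_maxr; first exact: measurable_cst.
  apply: measurable_minr; first exact: measurable_cst.
  by apply: measurable_dotp; [exact: measurable_fst|exact: measurable_snd].
Qed.

Let Xcontr u : \int[nu]_w `|X u w| <= 1.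
Proof.
have H0 := @bint_norm_bound R _ B nu (fun w => `|X u w|) sigma^-1.
apply: le_trans (ler_norm _) _; apply: le_trans (H0 _ _) _.
- by move=> w; rewrite normr_id; exact: X_le.
- exact/bmeas_norm/bker_row.
- by rewrite mulVf// gt_eqF// sigma_gt0.
Qed.

Let X_reflection w u v : X (reflection w u) (reflection w v) = X u v.
Proof.
have iS x : \1_(@sphere R s.+1) (reflection w x) = \1_(@sphere R s.+1) x :> R.
  rewrite !indicE; congr (_%:R); congr nat_of_bool.
  by apply/idP/idP; rewrite !inE => /sphere_reflection.
by rewrite /X /geodist dotp_reflection !iS.
Qed.

Let int_reflection w (f : B -> R) : bmeas f ->
  \int[nu]_x f (reflection w x) = \int[nu]_x f x.
Proof.
move=> bf; pose g : B -> B := reflection w.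
have mg : measurable_fun setT g.
  exact: measurable_isometry (enorm_reflection w).
have bfg : bmeas (fun x => f (g x)) by exact: bmeas_comp.
congr fine.
have := integral_pushforward mg (mu := nu) (D := setT) (f := EFin \o f).
rewrite preimage_setT => <- //; first last.
- exact: bmeas_integrable bfg.
- by apply/measurable_EFinP; exact: bf.1.
apply: eq_measure_integral => A mA _.
rewrite -[LHS]/(nu (g @^-1` A)) !nuE -(hausdorff_preimage (reflectionK w) (enorm_reflection w)).
congr hausdorff; apply/seteqP; split => x /= [Ax Sx]; split => //.
  by move: Ax; rewrite /g reflectionK.
  by move/sphere_reflection : Sx.
  by rewrite /g reflectionK.
by apply/sphere_reflection.
Qed.

Let kpoly_reflection w r u v :
  kpoly nu X r (reflection w u) (reflection w v) = kpoly nu X r u v.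
Proof.
apply: (@kpoly_invariant _ _ B nu X bX (reflection w)).
- exact: measurable_isometry (enorm_reflection w).
- exact: int_reflection.
- exact: X_reflection.
Qed.

Let energy_cst n (u : E) : sphere u -> kroot_energy nu X n u = kroot_energy nu X n e0.
Proof.
move=> /sphereE uu; have /sphereE ee := sphere_e0.
rewrite /kroot_energy !(kpolyM nu bX).
apply: (reflection_invariant_two_points (k := kpoly nu X _)); rewrite ?uu ?ee//.
Qed.

(** Continuity of [psi] at zero, read on inner products: [acos] decreases, so a
    cap is a geodesic ball. *)
Let psi_near0 e : 0 < e -> exists2 h, 0 < h &
  forall u v : E, sphere u -> sphere v -> 1 - h <= dotp u v ->
    1 - psi (geodist u v) <= e.
Proof.
move=> e_gt0; have [cpsi psi0 _] := hpsi.
have pi0 : 0 < pi :> R := pi_gt0 R.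
have [eta eta0 etaP] : exists2 eta, 0 < eta & forall t, 0 <= t <= pi ->
    t < eta -> 1 - psi t <= e.
  have [_ psi_right _] := (continuous_within_itvP psi pi0).1 cpsi.
  move/cvgrPdist_le : psi_right => /(_ _ e_gt0) [eta /= eta0 etaP].
  exists eta => // t /andP[t0 _] te.
  have [->|tn0] := eqVneq t 0; first by rewrite psi0 subrr ltW.
  rewrite -psi0; apply: le_trans (ler_norm _) (etaP t _ _).
    by rewrite /= sub0r normrN ger0_norm.
  by rewrite lt_def tn0 t0.
pose m := Num.min (eta / 2) (pi / 2).
have m0 : 0 < m by rewrite lt_min !divr_gt0.
have meta : m < eta.
  by rewrite gt_min ltr_pdivrMr// ltr_pMr// ltr1n.
have pi2 : pi / 2 <= pi :> R by lra.
have mpi : m <= pi by rewrite ge_min pi2 orbT.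
exists (1 - cos m).
  rewrite subr_gt0 -cos0 ltr_cos// in_itv /= ?lexx ?(ltW pi0)//.
  by rewrite (ltW m0) mpi.
move=> u v Su Sv; rewrite subKr => mc.
have th := geodist_itv Su Sv; apply: etaP => //.
apply: le_lt_trans meta; rewrite leNgt; apply/negP => lt.
have : cos (geodist u v) < cos m.
  by rewrite ltr_cos// in_itv /= ?th// (ltW m0) mpi.
rewrite /geodist acosK; first by rewrite ltNge mc.
by rewrite in_itv /= dotp_sphere_itv.
Qed.

Let X_caps v e : sphere (v : E) -> 0 < e -> exists C : set B,
  [/\ measurable C, (0 < nu C)%E, C `<=` @sphere R s.+1 &
      forall w z, C w -> `|X z w - X z v| <= e].
Proof.
move=> Sv e_gt0.
have si : 0 < sigma^-1 by rewrite invr_gt0 sigma_gt0.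
have e2 : 0 < (e / sigma^-1) ^+ 2 / 2 by rewrite divr_gt0// exprn_gt0// divr_gt0.
have [h h0 hP] := psi_near0 e2.
exists (cap v h); split.
- exact: measurable_cap.
- rewrite nuE setIidl; first exact: hausdorff_cap_gt0.
  by move=> w [].
- by move=> w [].
move=> w z [Sw wv].
have [Sz|Sz] := pselect (sphere (z : E)); last first.
  by rewrite !X_outl// subrr normr0 ltW.
rewrite -ler_sqr ?nnegrE ?(ltW e_gt0)// real_normK ?num_real//.
apply: le_trans (psd_modulus Xsym Xpsd z w v) _.
rewrite !Xdiag// X_sphere//; have := hP w v Sw Sv wv.
rewrite -(ler_pM2l (_ : 0 < 2 * sigma^-1 ^+ 2)); last by rewrite mulr_gt0// exprn_gt0.
move=> H1.
have E1 : 2 * sigma^-1 ^+ 2 * ((e / sigma^-1) ^+ 2 / 2) = e ^+ 2.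
  by field; rewrite gt_eqF// sigma_gt0.
rewrite E1 in H1; apply: le_trans H1.
by rewrite le_eqVlt; apply/orP; left; apply/eqP; ring.
Qed.

Lemma sphere_convolution_root : exists g : E -> E -> R, isotropic g /\
  forall u v : E, sphere u -> sphere v ->
    sconv_exists g g u v /\ psi (geodist u v) = sconv g g u v.
Proof.
have [N NP] := kernel_root_exists bX Xsym Xpsd sigma_gt0 Xcontr sphere_e0
  energy_cst X_caps.
set g0 := (fun u v => _) in NP.
have g0_refl w x y : g0 (reflection w x) (reflection w y) = g0 x y.
  rewrite /g0 /limsup_fun; congr (fine (limn_esup _)); apply/funext => k.
  by rewrite /kroot kpoly_reflection.
pose g (u v : E) := Num.sqrt sigma * g0 u v.
have ggE u v w : g u w * g w v = sigma * (g0 u w * g0 w v).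
  rewrite /g mulrACA -expr2 sqr_sqrtr//; exact: ltW.
exists g; split.
  (* The value at the angle [t] is read off from any pair of points at that angle. *)
  pose D (t : R) := [set p : E * E | [/\ sphere p.1, sphere p.2 & geodist p.1 p.2 = t]].
  exists (fun t => g (xget (0, 0) (D t)).1 (xget (0, 0) (D t)).2) => u v Su Sv.
  have : D (geodist u v) (xget (0, 0) (D (geodist u v))).
    by apply: xgetPex; exists (u, v).
  case: (xget _ _) => u' v' [/= Su' Sv' dd].
  have uv : dotp u v = dotp u' v'.
    rewrite -[LHS]acosK; last by rewrite in_itv /= dotp_sphere_itv.
    rewrite -[RHS]acosK; last by rewrite in_itv /= dotp_sphere_itv.
    by rewrite -/(geodist u v) -dd.
  rewrite /g; congr (_ * _).
  move/sphereE : Su => Su; move/sphereE : Sv => Sv.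
  move/sphereE : Su' => Su'; move/sphereE : Sv' => Sv'.
  by apply: reflection_invariant_two_points; rewrite ?Su ?Sv.
move=> u v Su Sv; have [gi Xuv] := NP u v Su Sv.
have gi' : nu.-integrable setT (fun w => (g u w * g w v)%:E).
  rewrite (_ : (fun w => _) = fun w => (sigma%:E * (g0 u w * g0 w v)%:E)%E).
    exact: integrableZl.
  by apply/funext => w; rewrite ggE.
split; first exact: integrable_mfrestr gi'.
rewrite /sconv (integral_mfrestr gi').
transitivity (\int[nu]_w (g u w * g w v)) => //.
rewrite (_ : \int[nu]_w _ = sigma * \int[nu]_w (g0 u w * g0 w v)); last first.
  by rewrite -RintegralZl//; apply: eq_Rintegral => w _; rewrite ggE.
by rewrite -Xuv X_sphere// mulrA divff ?mul1r// gt_eqF// sigma_gt0.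
Qed.

End SphereKernel.

Theorem theorem1p1 (R : realType) (d : nat) (hd : (1 <= d)%N)
    (psi : R -> R) (hpsi : Psi d psi) :
  exists g : 'rV[R]_d.+1 -> 'rV[R]_d.+1 -> R,
    isotropic g /\
    forall u v : 'rV[R]_d.+1, sphere u -> sphere v ->
      sconv_exists g g u v /\ psi (geodist u v) = sconv g g u v.
Proof.
case: d hd hpsi => [//|s] _ hpsi; exact: sphere_convolution_root.
Qed.
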